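(* Let $k$ be a field and let $A$ and $B$ be two finite dimensional self-injective $k$-algebras with no semisimple summands. If the lower triangular matrix algebras $\Lambda:=T_2(A)$ and $\Gamma:=T_2(B)$ are stably equivalent, then $A$ and $B$ are Morita equivalent.
   Context: For a finite dimensional $k$-algebra $A$, $T_2(A)$ denotes the lower triangular matrix algebra $\left(\begin{array}{cc} A&0\\ A&A\end{array}\right)$. For a finite dimensional $k$-algebra $C$, $\mathrm{mod}\,C$ denotes the category of finite dimensional left $C$-modules, and $\underline{\mathrm{mod}}\,C$ denotes its stable category modulo projective modules, i.e. the quotient of $\mathrm{mod}\,C$ by the ideal of maps that factor through projective modules. Two finite dimensional $k$-algebras $C$ and $C'$ are stably equivalent if $\underline{\mathrm{mod}}\,C$ and $\underline{\mathrm{mod}}\,C'$ are equivalent as $k$-categories. ''No semisimple summands'' means that the algebra has no nonzero semisimple algebra as a direct factor. *)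

(* Defs.v *)
From HB Require Import structures.
From mathcomp Require Import all_boot all_order all_algebra all_field.
From mathcomp Require Import boolp.

Set Implicit Arguments.
Unset Strict Implicit.
Unset Printing Implicit Defensive.

Import GRing.Theory.
Local Open Scope ring_scope.
Local Open Scope quotient_scope.

(* Finite dimensional algebras over a field k are falgTypes over k (so 1 != 0);
   they need not be commutative.  All modules are left modules. *)

Record kcat (k : fieldType) := KCat {
  obj :> Type;
  mor : obj -> obj -> lmodType k;
  idm : forall x, mor x x;
  comp : forall x y z, mor y z -> mor x y -> mor x z;
  compA : forall x y z t (h : mor z t) (g : mor y z) (f : mor x y),
    comp h (comp g f) = comp (comp h g) f;
  comp1m : forall x y (f : mor x y), comp (idm y) f = f;
  compm1 : forall x y (f : mor x y), comp f (idm x) = f;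
  comp_linearl : forall x y z (f : mor x y),
    linear (fun g : mor y z => comp g f);
  comp_linearr : forall x y z (g : mor y z),
    linear (fun f : mor x y => comp g f)
}.
Arguments mor {k} _ _ _.
Arguments idm {k} _ _.
Arguments comp {k _ x y z} _ _.

Record kfunctor (k : fieldType) (C D : kcat k) := KFunctor {
  fobj :> C -> D;
  fmor : forall x y, {linear mor C x y -> mor D (fobj x) (fobj y)};
  fmor1 : forall x, fmor x x (idm C x) = idm D (fobj x);
  fmorM : forall x y z (g : mor C y z) (f : mor C x y),
    fmor x z (comp g f) = comp (fmor y z g) (fmor x y f)
}.
Arguments fmor {k C D} _ {x y}.

Section Functors.
Variable k : fieldType.

Definition idfunctor (C : kcat k) : kfunctor C C :=
  @KFunctor k C C id (fun _ _ => idfun) (fun _ => erefl) (fun _ _ _ _ _ => erefl).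

Section Comp.
Variables (C D E : kcat k) (G : kfunctor D E) (F : kfunctor C D).

Fact compfunctor1 x : fmor G (fmor F (idm C x)) = idm E (G (F x)).
Proof. by rewrite !fmor1. Qed.

Fact compfunctorM x y z (g : mor C y z) (f : mor C x y) :
  fmor G (fmor F (comp g f)) = comp (fmor G (fmor F g)) (fmor G (fmor F f)).
Proof. by rewrite !fmorM. Qed.

Definition compfunctor : kfunctor C E :=
  @KFunctor k C E (fun x => G (F x)) (fun _ _ => fmor G \o fmor F)
    compfunctor1 compfunctorM.
End Comp.

Definition nat_iso (C D : kcat k) (F G : kfunctor C D) : Prop :=
  exists (u : forall x, mor D (F x) (G x)) (v : forall x, mor D (G x) (F x)),
    [/\ forall x, comp (v x) (u x) = idm D (F x),
        forall x, comp (u x) (v x) = idm D (G x)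
      & forall x y (f : mor C x y), comp (u y) (fmor F f) = comp (fmor G f) (u x)].

Definition kcat_equiv (C D : kcat k) : Prop :=
  exists (F : kfunctor C D) (G : kfunctor D C),
    nat_iso (compfunctor G F) (idfunctor C) /\
    nat_iso (compfunctor F G) (idfunctor D).

End Functors.

Record ideal (k : fieldType) (C : kcat k) := Ideal {
  inI : forall x y, mor C x y -> Prop;
  ideal0 : forall x y, inI (0 : mor C x y);
  idealP : forall x y (a : k) (f g : mor C x y),
    inI f -> inI g -> inI (a *: f + g);
  idealMl : forall x y z (g : mor C y z) (f : mor C x y),
    inI f -> inI (comp g f);
  idealMr : forall x y z (g : mor C y z) (f : mor C x y),
    inI g -> inI (comp g f)
}.
Arguments inI {k C} _ {x y} _.

Section QuotientCategory.
Variables (k : fieldType) (C : kcat k) (I : ideal C).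

Section Mor.
Variables x y : C.

Definition ideal_pred : {pred mor C x y} := fun f => `[< inI I f >].

Fact ideal_pred_zmod_closed : zmod_closed ideal_pred.
Proof.
split=> [|f g /asboolP If /asboolP Ig]; apply/asboolP; first exact: ideal0.
by rewrite addrC -scaleN1r; apply: idealP.
Qed.

HB.instance Definition _ :=
  GRing.isZmodClosed.Build (mor C x y) ideal_pred ideal_pred_zmod_closed.

Definition qmor := Quotient.quot ideal_pred.

HB.instance Definition _ := GRing.Zmodule.on qmor.

Definition qpi (f : mor C x y) : qmor := \pi_(Quotient.quot ideal_pred) f.
Definition qrepr (f : qmor) : mor C x y :=
  repr (f : Quotient.quot ideal_pred).

Lemma qreprK : cancel qrepr qpi.
Proof. by move=> f; rewrite /qpi /qrepr reprK. Qed.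

Lemma eq_qpi f g : (qpi f = qpi g) <-> inI I (f - g).
Proof.
split=> [/eqP|/asboolP Ifg]; last by apply/eqP; rewrite -Quotient.idealrBE.
by rewrite -Quotient.idealrBE => /asboolP.
Qed.

Lemma qpiD f g : qpi (f + g) = qpi f + qpi g.
Proof. exact: Quotient.pi_add. Qed.

Definition qscale (a : k) (f : qmor) : qmor := qpi (a *: qrepr f).

Lemma idealZ a (f : mor C x y) : inI I f -> inI I (a *: f).
Proof. by move=> If; rewrite -[_ *: _]addr0; apply: idealP If (ideal0 _ _ _). Qed.

Lemma qpiZ a f : qpi (a *: f) = qscale a (qpi f).
Proof.
apply/eq_qpi; rewrite -scalerBr; apply/idealZ/eq_qpi.
by rewrite qreprK.
Qed.

Fact qscaleA a b f : qscale a (qscale b f) = qscale (a * b) f.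
Proof. by rewrite -[f]qreprK -!qpiZ scalerA. Qed.
Fact qscale1 : left_id 1 qscale.
Proof. by move=> f; rewrite -[f]qreprK -!qpiZ scale1r. Qed.
Fact qscaleDr : right_distributive qscale +%R.
Proof. by move=> a f g; rewrite -[f]qreprK -[g]qreprK -qpiD -!qpiZ -qpiD scalerDr. Qed.
Fact qscaleDl f : {morph qscale^~ f : a b / a + b}.
Proof. by move=> a b; rewrite -[f]qreprK -!qpiZ -qpiD scalerDl. Qed.

HB.instance Definition _ :=
  GRing.Zmodule_isLmodule.Build k qmor qscaleA qscale1 qscaleDr qscaleDl.

Lemma qpi_linear : linear qpi.
Proof. by move=> a f g; rewrite qpiD qpiZ. Qed.

End Mor.

Definition qcomp x y z (g : qmor y z) (f : qmor x y) : qmor x z :=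
  qpi (comp (qrepr g) (qrepr f)).

Fact comp_subl x y z (g g' : mor C y z) (f : mor C x y) :
  comp (g - g') f = comp g f - comp g' f.
Proof.
have := comp_linearl f (-1) g' g.
by rewrite /= !scaleN1r ![- _ + _]addrC.
Qed.

Fact comp_subr x y z (g : mor C y z) (f f' : mor C x y) :
  comp g (f - f') = comp g f - comp g f'.
Proof.
have := comp_linearr g (-1) f' f.
by rewrite /= !scaleN1r ![- _ + _]addrC.
Qed.

Lemma qpiM x y z (g : mor C y z) (f : mor C x y) :
  qpi (comp g f) = qcomp (qpi g) (qpi f).
Proof.
transitivity (qpi (comp (qrepr (qpi g)) f)); apply/eq_qpi.
  by rewrite -comp_subl; apply/idealMr/eq_qpi; rewrite qreprK.
by rewrite -comp_subr; apply/idealMl/eq_qpi; rewrite qreprK.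
Qed.

Fact qcompA x y z t (h : qmor z t) (g : qmor y z) (f : qmor x y) :
  qcomp h (qcomp g f) = qcomp (qcomp h g) f.
Proof. by rewrite -[h]qreprK -[g]qreprK -[f]qreprK -!qpiM compA. Qed.
Fact qcomp1m x y (f : qmor x y) : qcomp (qpi (idm C y)) f = f.
Proof. by rewrite -[f]qreprK -qpiM comp1m. Qed.
Fact qcompm1 x y (f : qmor x y) : qcomp f (qpi (idm C x)) = f.
Proof. by rewrite -[f]qreprK -qpiM compm1. Qed.
Fact qcomp_linearl x y z (f : qmor x y) : linear (fun g : qmor y z => qcomp g f).
Proof.
move=> a g h; rewrite -[f]qreprK -[g]qreprK -[h]qreprK.
by rewrite -qpi_linear -!qpiM comp_linearl qpi_linear.
Qed.
Fact qcomp_linearr x y z (g : qmor y z) : linear (fun f : qmor x y => qcomp g f).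
Proof.
move=> a f h; rewrite -[f]qreprK -[g]qreprK -[h]qreprK.
by rewrite -qpi_linear -!qpiM comp_linearr qpi_linear.
Qed.

Definition quotient_cat : kcat k :=
  @KCat k C (fun x y => qmor x y) (fun x => qpi (idm C x)) qcomp
    qcompA qcomp1m qcompm1 qcomp_linearl qcomp_linearr.

End QuotientCategory.

Definition projective_module (R : nzRingType) (P : lmodType R) : Prop :=
  forall (M N : lmodType R) (p : {linear M -> N}) (f : {linear P -> N}),
    (forall y, exists x, p x = y) ->
    exists g : {linear P -> M}, forall x, p (g x) = f x.

Definition injective_module (R : nzRingType) (Q : lmodType R) : Prop :=
  forall (M N : lmodType R) (i : {linear M -> N}) (f : {linear M -> Q}),
    injective i ->
    exists g : {linear N -> Q}, forall x, g (i x) = f x.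

Section ModuleCategory.
Variables (k : fieldType) (A : algType k).

(* An A-module carries the k-structure a . m := a%:A *: m. *)
Definition finite_dim (M : lmodType A) : Prop :=
  exists (n : nat) (s : 'I_n -> M),
    forall x, exists c : 'I_n -> k, x = \sum_i (c i)%:A *: s i.

Record fdmod := FDMod { fdmod_sort :> lmodType A; _ : finite_dim fdmod_sort }.

Section Hom.
Variables M N : lmodType A.

Definition modhom : Type := {linear M -> N}.
Definition modhom_fun (f : modhom) : M -> N := (f : {linear M -> N}).
Coercion modhom_fun : modhom >-> Funclass.

Lemma modhomP (f g : modhom) : (forall x, f x = g x) -> f = g.
Proof.
case: f g => [f [[[f1 f2]] [f3]]] [g [[[g1 g2]] [g3]]] /= fg.
have {}fg : f = g by apply/funext.
case: g / fg in g1 g2 g3 *.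
by rewrite (Prop_irrelevance f1 g1) (Prop_irrelevance f2 g2) (Prop_irrelevance f3 g3).
Qed.

HB.instance Definition _ := gen_eqMixin modhom.
HB.instance Definition _ := gen_choiceMixin modhom.

Definition modhom_zero : modhom := \0 : {linear M -> N}.
Definition modhom_opp (f : modhom) : modhom :=
  (\- (f : {linear M -> N})) : {linear M -> N}.
Definition modhom_add (f g : modhom) : modhom :=
  ((f : {linear M -> N}) \+ (g : {linear M -> N})) : {linear M -> N}.

Fact modhom_addA : associative modhom_add.
Proof. by move=> f g h; apply: modhomP => x; apply: addrA. Qed.
Fact modhom_addC : commutative modhom_add.
Proof. by move=> f g; apply: modhomP => x; apply: addrC. Qed.
Fact modhom_add0 : left_id modhom_zero modhom_add.
Proof. by move=> f; apply: modhomP => x; apply: add0r. Qed.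
Fact modhom_addN : left_inverse modhom_zero modhom_opp modhom_add.
Proof. by move=> f; apply: modhomP => x; apply: addNr. Qed.

HB.instance Definition _ := GRing.isZmodule.Build modhom
  modhom_addA modhom_addC modhom_add0 modhom_addN.

Definition modhom_scale_fun (a : k) (f : modhom) (x : M) : N := a%:A *: f x.

Fact modhom_scale_linear a f : linear (modhom_scale_fun a f).
Proof.
move=> b x y; rewrite /modhom_scale_fun /modhom_fun linearP scalerDr !scalerA.
by rewrite -scalerAl -scalerAr mul1r mulr1.
Qed.

HB.instance Definition _ a f := GRing.isLinear.Build A M N *:%R
  (modhom_scale_fun a f) (modhom_scale_linear a f).

Definition modhom_scale (a : k) (f : modhom) : modhom :=
  modhom_scale_fun a f : {linear M -> N}.

Fact modhom_scaleA a b f :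
  modhom_scale a (modhom_scale b f) = modhom_scale (a * b) f.
Proof.
apply: modhomP => x; rewrite /= /modhom_scale_fun scalerA.
by rewrite -scalerAl mul1r scalerA.
Qed.
Fact modhom_scale1 : left_id 1 modhom_scale.
Proof. by move=> f; apply: modhomP => x; rewrite /= /modhom_scale_fun !scale1r. Qed.
Fact modhom_scaleDr : right_distributive modhom_scale +%R.
Proof. by move=> a f g; apply: modhomP => x; apply: scalerDr. Qed.
Fact modhom_scaleDl f : {morph modhom_scale^~ f : a b / a + b}.
Proof.
by move=> a b; apply: modhomP => x; rewrite /= /modhom_scale_fun !scalerDl.
Qed.

HB.instance Definition _ := GRing.Zmodule_isLmodule.Build k modhom
  modhom_scaleA modhom_scale1 modhom_scaleDr modhom_scaleDl.

End Hom.

Definition modid (M : lmodType A) : modhom M M := idfun : {linear M -> M}.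
Definition modcomp (M N P : lmodType A) (g : modhom N P) (f : modhom M N) :
    modhom M P :=
  ((g : {linear N -> P}) \o (f : {linear M -> N})) : {linear M -> P}.

Fact modcompA (M N P Q : fdmod) (h : modhom P Q) (g : modhom N P)
  (f : modhom M N) : modcomp h (modcomp g f) = modcomp (modcomp h g) f.
Proof. exact: modhomP. Qed.
Fact modcomp1m (M N : fdmod) (f : modhom M N) : modcomp (modid N) f = f.
Proof. exact: modhomP. Qed.
Fact modcompm1 (M N : fdmod) (f : modhom M N) : modcomp f (modid M) = f.
Proof. exact: modhomP. Qed.
Fact modcomp_linearl (M N P : fdmod) (f : modhom M N) :
  linear (fun g : modhom N P => modcomp g f).
Proof. by move=> a g h; apply: modhomP. Qed.
Fact modcomp_linearr (M N P : fdmod) (g : modhom N P) :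
  linear (fun f : modhom M N => modcomp g f).
Proof.
move=> a f h; apply: modhomP => x.
rewrite /= /modhom_fun [LHS]linearD; congr (_ + _).
exact: (linearZ_LR (g : {linear N -> P}) a%:A (f x)).
Qed.

Definition mod_cat : kcat k :=
  @KCat k fdmod (fun M N => modhom M N) (fun M => modid M)
    (fun M N P => @modcomp M N P)
    modcompA modcomp1m modcompm1 modcomp_linearl modcomp_linearr.

Definition factors_projective (M N : fdmod) (f : modhom M N) : Prop :=
  exists (P : fdmod) (g : modhom P N) (h : modhom M P),
    projective_module P /\ f = modcomp g h.

Lemma finite_dim0 : finite_dim ('rV[A]_0).
Proof.
exists 0, (fun _ => 0) => x; exists (fun _ => 0).
by rewrite big_ord0; apply/rowP; case.
Qed.

Lemma projective0 : projective_module ('rV[A]_0).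
Proof.
move=> M N p f _; exists (\0 : {linear _ -> _}) => x.
have -> : x = 0 by apply/rowP; case.
by rewrite !linear0.
Qed.

Lemma finite_dim_pair (M N : lmodType A) :
  finite_dim M -> finite_dim N -> finite_dim (M * N)%type.
Proof.
move=> [m [s Hs]] [n [t Ht]].
exists (m + n)%N, (fun i => match split i with
  inl i => (s i, 0) | inr j => (0, t j) end) => -[x y].
have [c ->] := Hs x; have [d ->] := Ht y.
exists (fun i => match split i with inl i => c i | inr j => d j end).
have splitl i : split (lshift n i) = inl i := unsplitK (inl i).
have splitr i : split (rshift m i) = inr i := unsplitK (inr i).
rewrite big_split_ord.
under eq_bigr do rewrite splitl.
under [X in _ = _ + X]eq_bigr do rewrite splitr.
set u := (X in _ = X); rewrite [u]surjective_pairing /u !linearD !linear_sum /=.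
rewrite [X in _ + X]big1 ?addr0 => [|i _]; last by rewrite scaler0.
by rewrite [X in (_, X + _)]big1 ?add0r => // i _; rewrite scaler0.
Qed.

Definition modinl (M N : lmodType A) (x : M) : M * N := (x, 0).
Definition modinr (M N : lmodType A) (y : N) : M * N := (0, y).

Fact modinl_linear (M N : lmodType A) : linear (@modinl M N).
Proof. by move=> a x y; congr pair; rewrite /= scaler0 addr0. Qed.
Fact modinr_linear (M N : lmodType A) : linear (@modinr M N).
Proof. by move=> a x y; congr pair; rewrite /= scaler0 addr0. Qed.

HB.instance Definition _ (M N : lmodType A) := GRing.isLinear.Build A M (M * N)%type *:%R
  (@modinl M N) (@modinl_linear M N).
HB.instance Definition _ (M N : lmodType A) := GRing.isLinear.Build A N (M * N)%type *:%R
  (@modinr M N) (@modinr_linear M N).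

Lemma projective_pair (P Q : lmodType A) :
  projective_module P -> projective_module Q -> projective_module (P * Q)%type.
Proof.
move=> projP projQ M N p f p_surj.
have [g Hg] := projP M N p (f \o @modinl P Q) p_surj.
have [h Hh] := projQ M N p (f \o @modinr P Q) p_surj.
exists ((g \o fst) \+ (h \o snd)) => -[x y] /=.
rewrite linearD Hg Hh /= -linearD; congr (f _).
by congr pair; rewrite /= ?addr0 ?add0r.
Qed.

Fact factors_projective0 (M N : fdmod) : factors_projective (0 : modhom M N).
Proof.
exists (FDMod finite_dim0), 0, 0; split; first exact: projective0.
by apply: modhomP.
Qed.

Fact factors_projectiveP (M N : fdmod) (a : k) (f g : modhom M N) :
  factors_projective f -> factors_projective g ->
  factors_projective (a *: f + g).
Proof.
move=> [[P fP] [u [v [projP ->]]]] [[Q fQ] [r [s [projQ ->]]]].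
pose R := FDMod (finite_dim_pair fP fQ).
pose ur : {linear R -> N} :=
  (((a *: u : modhom P N) : {linear P -> N}) \o fst)
    \+ ((r : {linear Q -> N}) \o snd).
pose vs : {linear M -> R} :=
  (@modinl P Q \o (v : {linear M -> P})) \+ (@modinr P Q \o (s : {linear M -> Q})).
exists R, ur, vs; split; first exact: projective_pair.
apply: modhomP => x; rewrite /modhom_fun /= /modhom_fun /= /modhom_fun /=.
by rewrite addr0 add0r.
Qed.

Fact factors_projectiveMl (M N P : fdmod) (g : modhom N P) (f : modhom M N) :
  factors_projective f -> factors_projective (modcomp g f).
Proof.
move=> [Q [u [v [projQ ->]]]]; exists Q, (modcomp g u), v.
by split=> //; apply: modhomP.
Qed.

Fact factors_projectiveMr (M N P : fdmod) (g : modhom N P) (f : modhom M N) :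
  factors_projective g -> factors_projective (modcomp g f).
Proof.
move=> [Q [u [v [projQ ->]]]]; exists Q, u, (modcomp v f).
by split=> //; apply: modhomP.
Qed.

Definition projective_ideal : ideal mod_cat :=
  @Ideal k mod_cat factors_projective factors_projective0 factors_projectiveP
    factors_projectiveMl factors_projectiveMr.

Definition stable_cat : kcat k := quotient_cat projective_ideal.

End ModuleCategory.

(* Morita equivalence of finite dimensional algebras is taken in its usual form
   for such algebras: a k-linear equivalence between the categories of finite
   dimensional modules. *)
Definition morita_equivalent (k : fieldType) (A B : algType k) : Prop :=
  kcat_equiv (mod_cat A) (mod_cat B).

Definition stably_equivalent (k : fieldType) (A B : algType k) : Prop :=
  kcat_equiv (stable_cat A) (stable_cat B).

Section Falgebras.
Variable k : fieldType.

(* A^o is the regular left module: a *: x is the product a * x. *)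
Definition self_injective (A : falgType k) : Prop := injective_module A^o.

Definition left_ideal (A : falgType k) (U : {vspace A}) : Prop :=
  (fullv * U <= U)%VS.

Definition simple_left_ideal (A : falgType k) (U : {vspace A}) : Prop :=
  [/\ left_ideal U, U != 0%VS
    & forall V : {vspace A}, left_ideal V -> (V <= U)%VS -> V = 0%VS \/ V = U].

(* Left ideals are the submodules of the regular left module; A is semisimple
   when the latter is a direct sum of simple submodules. *)
Definition semisimple_algebra (A : falgType k) : Prop :=
  exists (n : nat) (U : 'I_n -> {vspace A}),
    [/\ forall i, simple_left_ideal (U i),
        directv (\sum_i U i) & (\sum_i U i)%VS = fullv].

Definition alg_iso (A B : algType k) : Prop :=
  exists f : {lrmorphism A -> B}, bijective f.

(* The first case is that of a zero complementary factor, as falgTypes are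
   nonzero. *)
Definition direct_factor (S A : falgType k) : Prop :=
  alg_iso A S \/ exists S' : falgType k, alg_iso A (S * S')%type.

Definition no_semisimple_summand (A : falgType k) : Prop :=
  forall S : falgType k, semisimple_algebra S -> ~ direct_factor S A.

End Falgebras.

Section T2.
Variables (k : fieldType) (A : falgType k).

(* is_trig_mx is lower triangularity: M i j = 0 for i < j. *)
Definition trig2 : {pred 'M[A]_2} := fun M => is_trig_mx M.

Record T2 := TrigMx { t2val :> 'M[A]_2; _ : t2val \in trig2 }.

HB.instance Definition _ := [isSub for t2val].
HB.instance Definition _ := [Choice of T2 by <:].

Lemma trig2P (M : 'M[A]_2) : reflect (M 0 1 = 0) (M \in trig2).
Proof.
apply: (iffP is_trig_mxP) => [/(_ 0 1 isT)//|M01 i j].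
by case: i j => [[|[|i]] //= Hi] [[|[|j]] //= Hj] // _; rewrite -[RHS]M01;
   congr (M _ _); apply: val_inj.
Qed.

Fact trig2_subring_closed : subring_closed trig2.
Proof.
split=> [|M N /trig2P M0 /trig2P N0|M N /trig2P M0 /trig2P N0]; apply/trig2P.
- by rewrite mxE.
- by rewrite !mxE M0 N0 subrr.
- rewrite mxE !big_ord_recl big_ord0 (_ : lift ord0 ord0 = 1); last exact: val_inj.
  by rewrite N0 M0 mul0r mulr0 !addr0.
Qed.

HB.instance Definition _ := GRing.SubChoice_isSubNzRing.Build 'M[A]_2 trig2 T2
  trig2_subring_closed.

Fact t2scale_subproof (a : k) (M : T2) : map_mx (fun x => a *: x) M \in trig2.
Proof. by have /trig2P /= M0 := valP M; apply/trig2P; rewrite mxE M0 scaler0. Qed.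

Definition t2scale a M : T2 := TrigMx (t2scale_subproof a M).

Fact t2scaleA a b M : t2scale a (t2scale b M) = t2scale (a * b) M.
Proof. by apply/val_inj/matrixP => i j; rewrite !mxE scalerA. Qed.
Fact t2scale1 : left_id 1 t2scale.
Proof. by move=> M; apply/val_inj/matrixP => i j; rewrite !mxE scale1r. Qed.
Fact t2scaleDr : right_distributive t2scale +%R.
Proof. by move=> a M N; apply/val_inj/matrixP => i j; rewrite !mxE scalerDr. Qed.
Fact t2scaleDl M : {morph t2scale^~ M : a b / a + b}.
Proof. by move=> a b; apply/val_inj/matrixP => i j; rewrite !mxE scalerDl. Qed.

HB.instance Definition _ := GRing.Zmodule_isLmodule.Build k T2
  t2scaleA t2scale1 t2scaleDr t2scaleDl.

Fact t2scaleAl (a : k) (M N : T2) : a *: (M * N) = (a *: M) * N.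
Proof.
apply/val_inj/matrixP => i j; rewrite !mxE scaler_sumr.
by apply: eq_bigr => l _; rewrite !mxE scalerAl.
Qed.
HB.instance Definition _ := GRing.LSemiModule_isLSemiAlgebra.Build k T2 t2scaleAl.

Fact t2scaleAr (a : k) (M N : T2) : a *: (M * N) = M * (a *: N).
Proof.
apply/val_inj/matrixP => i j; rewrite !mxE scaler_sumr.
by apply: eq_bigr => l _; rewrite !mxE scalerAr.
Qed.
HB.instance Definition _ := GRing.LSemiAlgebra_isSemiAlgebra.Build k T2 t2scaleAr.

Definition t2_entries (M : T2) : A * A * A :=
  (t2val M 0 0, t2val M 1 0, t2val M 1 1).

Fact t2_of_entries_subproof (x : A * A * A) :
  \matrix_(i < 2, j < 2)
    (if i == 0 then if j == 0 then x.1.1 else 0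
     else if j == 0 then x.1.2 else x.2) \in trig2.
Proof. by apply/trig2P; rewrite mxE. Qed.

Definition t2_of_entries x : T2 := TrigMx (t2_of_entries_subproof x).

Fact t2_entries_linear : linear t2_entries.
Proof. by move=> a M N; rewrite /t2_entries /= !mxE. Qed.

Lemma t2_entriesK : cancel t2_entries t2_of_entries.
Proof.
case=> M M_trig; apply/val_inj/matrixP => i j; rewrite mxE /=.
have /trig2P M0 := M_trig.
case: i j => [[|[|i]] //= Hi] [[|[|j]] //= Hj]; rewrite -?M0;
  by congr (M _ _); apply: val_inj.
Qed.

Lemma t2_of_entriesK : cancel t2_of_entries t2_entries.
Proof. by move=> [[a b] c]; rewrite /t2_entries /= !mxE. Qed.

Fact t2_vect_axiom : SemiVector.axiom (dim (A * A * A)%type) T2.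
Proof.
have [r [rZ rD] r_bij] := VectorInternalTheory.v2r_subproof (A * A * A)%type.
exists (r \o t2_entries); last first.
  apply: bij_comp r_bij _.
  by exists t2_of_entries; [exact: t2_entriesK | exact: t2_of_entriesK].
split=> [a M|M N] /=.
  by rewrite -rZ -[a *: M]addr0 t2_entries_linear {2}/t2_entries /= !mxE addr0.
by rewrite -rD -[M]scale1r t2_entries_linear !scale1r.
Qed.

HB.instance Definition _ := LSemiModule_hasFinDim.Build k T2 t2_vect_axiom.
HB.instance Definition _ := Algebra_isFalgebra.Build k T2.

End T2.

(* Main.v *)
(** A T_2(A)-module is a map X -> Y of A-modules, and X -> Y |-> ker(X -> Y) kills
    projectives, so it is a functor from the stable category of T_2(A) to mod A. Call an
    object of a category mono-injective if maps into it extend along monomorphisms, and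
    epi-projective if maps out of it lift along epimorphisms; both properties are invariant
    under equivalence. In the stable category of T_2(A), with A self-injective, the objects
    with both properties are those represented by some X -> Y with X projective and
    projective cokernel, that is, up to projectives, by P -> P/L with P projective. Since P
    is also injective, every map L -> L' extends to P -> P', and a map vanishing on L is
    stably zero: on this full subcategory the kernel functor is an equivalence onto mod A.
    Hence mod A is recovered from the stable category of T_2(A).

    Every finite dimensional module over the left self-injective algebra A embeds in a
    projective one. This needs every simple left module to embed in A, which is shown by
    a finiteness argument: T |-> T' = Ax, where xA is the k-dual of T, is injective on the
    finitely many isomorphism classes of simple modules, hence bijective. *)
From HB Require Import structures.
Require Import Defs.
From mathcomp Require Import all_boot all_order all_algebra all_field.
From mathcomp Require Import boolp.

Set Implicit Arguments.
Unset Strict Implicit.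
Unset Printing Implicit Defensive.

Import GRing.Theory.
Local Open Scope ring_scope.
Local Open Scope quotient_scope.

Definition linear_of (R : nzRingType) (M N : lmodType R) (f : M -> N) (fP : linear f) :
    {linear M -> N} :=
  HB.pack_for {linear M -> N} f (GRing.isLinear.Build R M N *:%R f fP).

(** * Kernels, cokernels and factorization of module maps *)

Section KernelModule.
Variables (R : nzRingType) (M N : lmodType R) (f : {linear M -> N}).

Definition kerm_pred : {pred M} := fun x => f x == 0.

Fact kerm_submod_closed : submod_closed kerm_pred.
Proof.
split=> [|a x y /eqP fx /eqP fy]; apply/eqP; first exact: linear0.
by rewrite linearP fx fy scaler0 addr0.
Qed.

Record kerm := Kerm { kerm_val : M; _ : kerm_val \in kerm_pred }.
HB.instance Definition _ := [isSub for kerm_val].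
HB.instance Definition _ := [Choice of kerm by <:].
HB.instance Definition _ := GRing.SubChoice_isSubLmodule.Build R M kerm_pred kerm
  kerm_submod_closed.

Definition kerm_inj : {linear kerm -> M} := \val.

Lemma kerm_injI : injective kerm_inj.
Proof. exact: val_inj. Qed.

Lemma kermE (x : kerm) : f (kerm_inj x) = 0.
Proof. by apply/eqP; apply: (valP x). Qed.

Lemma kerm_ex x : f x = 0 -> exists y, kerm_inj y = x.
Proof. by move=> /eqP fx; exists (Kerm fx). Qed.

End KernelModule.

Section FactorModule.
Variables (R : nzRingType) (M N : lmodType R) (f : {linear M -> N}).

Definition cokerm_pred : {pred N} := fun y => `[< exists x, f x = y >].

Lemma cokerm_predP y : reflect (exists x, f x = y) (y \in cokerm_pred).
Proof. exact: asboolP. Qed.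

Fact cokerm_zmod_closed : zmod_closed cokerm_pred.
Proof.
split=> [|y z /asboolP[u <-] /asboolP[v <-]]; apply/asboolP.
  by exists 0; rewrite linear0.
by exists (u - v); rewrite linearB.
Qed.

HB.instance Definition _ := GRing.isZmodClosed.Build N cokerm_pred cokerm_zmod_closed.

Definition cokerm := Quotient.quot cokerm_pred.
HB.instance Definition _ := GRing.Zmodule.on cokerm.

Definition cokerm_pi (y : N) : cokerm := \pi_(Quotient.quot cokerm_pred) y.
Definition cokerm_repr (y : cokerm) : N := repr (y : Quotient.quot cokerm_pred).

Lemma cokerm_reprK : cancel cokerm_repr cokerm_pi.
Proof. by move=> y; rewrite /cokerm_pi /cokerm_repr reprK. Qed.

Lemma cokerm_eq y z : cokerm_pi y = cokerm_pi z <-> exists x, f x = y - z.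
Proof.
split=> [/eqP|/cokerm_predP yz]; last by apply/eqP; rewrite -Quotient.idealrBE.
by rewrite -Quotient.idealrBE => /cokerm_predP.
Qed.

Lemma cokerm_piD y z : cokerm_pi (y + z) = cokerm_pi y + cokerm_pi z.
Proof. exact: Quotient.pi_add. Qed.

Definition cokerm_scale (a : R) (y : cokerm) : cokerm := cokerm_pi (a *: cokerm_repr y).

Lemma cokerm_piZ a y : cokerm_pi (a *: y) = cokerm_scale a (cokerm_pi y).
Proof.
apply/cokerm_eq; rewrite -scalerBr.
have /cokerm_eq[x fx] := esym (cokerm_reprK (cokerm_pi y)).
by exists (a *: x); rewrite linearZ /= fx.
Qed.

Fact cokerm_scaleA a b y : cokerm_scale a (cokerm_scale b y) = cokerm_scale (a * b) y.
Proof. by rewrite -[y]cokerm_reprK -!cokerm_piZ scalerA. Qed.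
Fact cokerm_scale1 : left_id 1 cokerm_scale.
Proof. by move=> y; rewrite -[y]cokerm_reprK -!cokerm_piZ scale1r. Qed.
Fact cokerm_scaleDr : right_distributive cokerm_scale +%R.
Proof.
move=> a y z; rewrite -[y]cokerm_reprK -[z]cokerm_reprK.
by rewrite -cokerm_piD -!cokerm_piZ -cokerm_piD scalerDr.
Qed.
Fact cokerm_scaleDl y : {morph cokerm_scale^~ y : a b / a + b}.
Proof. by move=> a b; rewrite -[y]cokerm_reprK -!cokerm_piZ -cokerm_piD scalerDl. Qed.

HB.instance Definition _ := GRing.Zmodule_isLmodule.Build R cokerm
  cokerm_scaleA cokerm_scale1 cokerm_scaleDr cokerm_scaleDl.

Fact cokerm_pi_linear : linear cokerm_pi.
Proof. by move=> a y z; rewrite cokerm_piD cokerm_piZ. Qed.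
HB.instance Definition _ := GRing.isLinear.Build R N cokerm *:%R cokerm_pi
  cokerm_pi_linear.

Lemma cokerm_pi_surj (y : cokerm) : exists z, cokerm_pi z = y.
Proof. by exists (cokerm_repr y); rewrite cokerm_reprK. Qed.

Lemma cokerm_pi_eq0 y : cokerm_pi y = 0 <-> exists x, f x = y.
Proof. by rewrite -[0](linear0 (cokerm_pi : {linear N -> cokerm})) cokerm_eq subr0. Qed.

End FactorModule.

Section Factorization.
Variable R : nzRingType.

Lemma choice_surj (T U : Type) (f : T -> U) :
  (forall y, exists x, f x = y) -> exists g, cancel g f.
Proof. by move=> /choice[g gK]; exists g. Qed.

Lemma factor_surj (M N Q : lmodType R) (u : {linear M -> N}) (v : {linear M -> Q}) :
    (forall y, exists x, u x = y) -> (forall x, u x = 0 -> v x = 0) ->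
  exists g : {linear N -> Q}, forall x, g (u x) = v x.
Proof.
move=> /choice_surj[s sK] uv.
have vE x y : u x = u y -> v x = v y.
  by move=> uxy; apply/subr0_eq; rewrite -linearB uv // linearB uxy subrr.
have gP : linear (v \o s).
  by move=> a x y; rewrite /= -linearP; apply: vE; rewrite linearP !sK.
by exists (linear_of gP) => x; apply: vE; rewrite sK.
Qed.

Lemma factor_inj (M N Q : lmodType R) (i : {linear N -> M}) (v : {linear Q -> M}) :
    injective i -> (forall x, exists y, i y = v x) ->
  exists g : {linear Q -> N}, forall x, i (g x) = v x.
Proof.
move=> i_inj /choice[g gE].
have gP : linear g by move=> a x y; apply: i_inj; rewrite linearP !gE linearP.
by exists (linear_of gP).
Qed.

(** Both maps descend to the quotient of [M] by the kernel of [u], where [u] becomes injective and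
    injectivity of [Q] applies. *)
Lemma injective_factor (Q M N : lmodType R) (u : {linear M -> N}) (v : {linear M -> Q}) :
    injective_module Q -> (forall x, u x = 0 -> v x = 0) ->
  exists g : {linear N -> Q}, forall x, g (u x) = v x.
Proof.
move=> injQ uv.
pose q : {linear M -> cokerm (kerm_inj u)} := cokerm_pi (kerm_inj u).
have q_surj : forall y, exists x, q x = y := @cokerm_pi_surj _ _ _ _.
have q0 x : q x = 0 <-> u x = 0.
  rewrite cokerm_pi_eq0; split=> [[y <-]|/kerm_ex//]; exact: kermE.
have [|u' u'E] := factor_surj (u := q) (v := u) q_surj; first by move=> x /q0.
have [|v' v'E] := factor_surj (u := q) (v := v) q_surj; first by move=> x /q0 /uv.
have [|g gE] := injQ _ _ u' v'.
  apply: raddf_inj => y; have [x <-] := q_surj y.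
  by move=> ux; apply/q0; rewrite -(u'E x).
by exists g => x; rewrite -(u'E x) gE (v'E x).
Qed.

Lemma injective_retract (P Q : lmodType R) (i : {linear P -> Q}) (p : {linear Q -> P}) :
  injective_module Q -> cancel i p -> injective_module P.
Proof.
move=> injQ iK M N j f j_inj.
have [g gE] := injQ M N j (i \o f) j_inj.
by exists (p \o g) => x; rewrite /= gE /= iK.
Qed.

Lemma injective_pair (P Q : lmodType R) :
  injective_module P -> injective_module Q -> injective_module (P * Q)%type.
Proof.
move=> injP injQ M N j f j_inj.
have [g gE] := injP M N j (fst \o f) j_inj.
have [h hE] := injQ M N j (snd \o f) j_inj.
have lP : linear (fun x => (g x, h x)) by move=> a x y; rewrite !linearP.
exists (linear_of lP) => x /=.
by rewrite gE hE /=; case: (f x).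
Qed.

Lemma projective_section (M P : lmodType R) (p : {linear M -> P}) :
    projective_module P -> (forall y, exists x, p x = y) ->
  exists s : {linear P -> M}, cancel s p.
Proof. by move=> projP p_surj; have [s sE] := projP _ _ p idfun p_surj; exists s. Qed.

Lemma injective0 : injective_module ('rV[R]_0).
Proof.
move=> M N i f _; exists (\0 : {linear _ -> _}) => x.
by apply/rowP; case.
Qed.

Lemma regular_projective : projective_module R^o.
Proof.
move=> M N p f p_surj; have [x px] := p_surj (f 1).
have gP : linear (fun a : R^o => (a : R) *: x).
  by move=> a b c; rewrite scalerDl scalerA.
exists (linear_of gP) => a /=.
by rewrite linearZ /= px -linearZ; congr (f _); apply: mulr1.
Qed.

End Factorization.

(** * Finite dimensional modules *)

(** A subspace of maximal dimension inside [S] is all of [S], since any further vector of [S] would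
    enlarge it. *)
Lemma vspace_of_pred (k : fieldType) (V : vectType k) (S : V -> Prop) :
    S 0 -> (forall a u v, S u -> S v -> S (a *: u + v)) ->
  exists U : {vspace V}, forall v, v \in U <-> S v.
Proof.
move=> S0 SP; pose D n := `[< exists2 U : {vspace V}, \dim U = n & forall v, v \in U -> S v >].
have D0 : exists n, D n.
  by exists 0%N; apply/asboolP; exists 0%VS; rewrite ?dimv0 // => v; rewrite memv0 => /eqP->.
have Dmax n : D n -> (n <= dim V)%N.
  by case/asboolP=> U <- _; rewrite -dimvf; apply/dimvS/subvf.
case: (ex_maxnP D0 Dmax) => n /asboolP[U dimU US] Umax.
exists U => v; split=> [/US//|Sv].
have /Umax : D (\dim (U + <[v]>)).
  apply/asboolP; exists (U + <[v]>)%VS => // w /memv_addP[u /US Su [y /vlineP[a ->] ->]].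
  by rewrite addrC; apply: SP.
rewrite -dimU => le_dim; rewrite memvE.
by have /eqP -> : U == (U + <[v]>)%VS; rewrite ?addvSr // eqEdim addvSl.
Qed.

Section FiniteDim.
Variables (k : fieldType) (A : falgType k).

Lemma scale_algA (M : lmodType A) (c d : k) (x : M) : c%:A *: (d%:A *: x) = (c * d)%:A *: x.
Proof. by rewrite !scalerA -scalerAl mul1r scalerA. Qed.

Lemma finite_dim_surj (M N : lmodType A) (p : {linear M -> N}) :
  (forall y, exists x, p x = y) -> finite_dim M -> finite_dim N.
Proof.
move=> p_surj [n [s sP]]; exists n, (p \o s) => y.
have [x <-] := p_surj y; have [c ->] := sP x; exists c.
by rewrite linear_sum; apply: eq_bigr => i _; rewrite linearZ.
Qed.

(** The coordinate rows over the generators of [N] that represent elements of the image of [j] form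
    a subspace of k^n. A basis of it, pulled back to [M], generates [M]. *)
Lemma finite_dim_inj (M N : lmodType A) (j : {linear M -> N}) :
  injective j -> finite_dim N -> finite_dim M.
Proof.
move=> j_inj [n [s sP]].
pose S (v : 'rV[k]_n) := exists x, j x = \sum_i (v 0 i)%:A *: s i.
have [||U US] := @vspace_of_pred _ _ S.
- by exists 0; rewrite linear0 big1 // => i _; rewrite mxE !scale0r.
- move=> a u v [x xE] [y yE]; exists (a%:A *: x + y).
  rewrite linearP xE yE scaler_sumr -big_split; apply: eq_bigr => i _ /=.
  by rewrite !mxE !scalerDl scale_algA.
have /choice[t tE] (i : 'I_(\dim U)) : S (tnth (vbasis U) i).
  by apply/US/vbasis_mem/mem_tnth.
exists (\dim U), t => x; have [c cE] := sP (j x).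
pose v := \row_i c i; have vU : v \in U.
  by apply/US; exists x; rewrite cE; apply: eq_bigr => i _; rewrite mxE.
exists (fun i => coord (vbasis U) i v); apply: j_inj.
rewrite linear_sum cE; under [RHS]eq_bigr do rewrite linearZ /= tE scaler_sumr.
rewrite exchange_big /=; apply: eq_bigr => i _.
rewrite -[c i](_ : v 0 i = c i); last by rewrite mxE.
rewrite {1}(coord_vbasis vU) summxE scaler_suml scaler_suml.
apply: eq_bigr => l _; rewrite mxE -(tnth_nth 0).
by rewrite scale_algA.
Qed.

Lemma finite_dim_regular : finite_dim (A^o : lmodType A).
Proof.
pose B := vbasis (fullv : {vspace A}).
exists (\dim (fullv : {vspace A})), (tnth B) => x.
exists (fun i => coord B i (x : A)).
rewrite {1}(coord_vbasis (memvf (x : A))); apply: eq_bigr => i _.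
rewrite -(tnth_nth 0); change (coord B i x *: tnth B i = (coord B i x)%:A * tnth B i).
by rewrite -scalerAl mul1r.
Qed.

(** The cover is free of finite rank and need not be minimal; as a finite power of A it is injective
    when A is self-injective. *)
Lemma projective_cover (M : lmodType A) : finite_dim M ->
  exists P : lmodType A, [/\ finite_dim P, projective_module P,
    self_injective A -> injective_module P
    & exists p : {linear P -> M}, forall y, exists x, p x = y].
Proof.
move=> [n [s sP]].
suff [P [fdP projP injP [p pE]]] : exists P : lmodType A,
    [/\ finite_dim P, projective_module P, self_injective A -> injective_module P
    & exists p : {linear P -> M}, forall i, exists x, p x = s i].
  exists P; split=> //; exists p => y; have [c ->] := sP y.
  have /choice[x xE] := pE; exists (\sum_i (c i)%:A *: x i).
  by rewrite linear_sum; apply: eq_bigr => i _; rewrite linearZ /= xE.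
elim: n s {sP} => [|n IHn] s.
  exists 'rV[A]_0; split; [exact: finite_dim0 | exact: projective0 | |].
    by move=> _; apply: injective0.
  by exists (\0 : {linear _ -> _}) => -[].
have [P [fdP projP injP [p pE]]] := IHn (fun i => s (lift ord0 i)).
exists (P * A^o)%type; split.
- exact: finite_dim_pair fdP finite_dim_regular.
- apply: projective_pair projP _; exact: regular_projective.
- by move=> injA; apply: injective_pair (injP injA) injA.
have lP : linear (fun x : P * A^o => p x.1 + (x.2 : A) *: s ord0).
  move=> a x y /=; rewrite linearP scalerDr scalerDl scalerA.
  by rewrite !addrA; congr (_ + _); rewrite -!addrA; congr (_ + _); rewrite addrC.
exists (linear_of lP) => i; case: (unliftP ord0 i) => [j ->|->] /=.
  by have [x xE] := pE j; exists (x, 0); rewrite /= scale0r addr0.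
by exists (0, 1); rewrite linear0 add0r scale1r.
Qed.

Lemma projective_injective (P : lmodType A) :
  self_injective A -> finite_dim P -> projective_module P -> injective_module P.
Proof.
move=> injA fdP projP; have [Q [_ _ injQ [p p_surj]]] := projective_cover fdP.
have [s sK] := projective_section projP p_surj.
exact: injective_retract (injQ injA) sK.
Qed.

End FiniteDim.

(** * Embedding modules into projective modules *)

Section LinearForms.
Variables (k : fieldType) (A : falgType k).

Lemma separating_form (U : {vspace A}) v : v \notin U ->
  exists2 f : {linear A -> k^o}, forall u, u \in U -> f u = 0 & f v != 0.
Proof.
move=> vU; pose e := vbasis (fullv : {vspace A}).
pose p : A -> A := fun x => x - projv U x.
have pP : linear p.
  by move=> a x y; rewrite /p linearP opprD addrACA scalerBr.
have [i ci] : exists i, coord e i (p v) != 0.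
  apply: contrapT => c0; case/negP: vU.
  have /subr0_eq-> : p v = 0; last exact: memv_proj.
  rewrite (coord_vbasis (memvf (p v))) big1 // => i _.
  have [->|ci] := eqVneq (coord e i (p v)) 0; first by rewrite scale0r.
  by case: c0; exists i.
have fP : linear (fun x => coord e i (p x) : k^o).
  by move=> a x y; rewrite pP linearP.
exists (linear_of fP) => // u uU.
by rewrite /= /p projv_id // subrr linear0.
Qed.

(** The forms [g (_ * c)] make up the row space of the matrix [G], so by duality [f] is one of them
    once it kills every [a] orthogonal to that space. *)
Lemma form_factor (g f : {linear A -> k^o}) :
    (forall a : A, (forall y : A, g (a * y) = 0) -> f a = 0) ->
  exists c : A, forall a : A, g (a * c) = f a.
Proof.
move=> gf; pose e := vbasis (fullv : {vspace A}).
have eE x : x = \sum_i coord e i x *: e`_i := coord_vbasis (memvf x).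
pose d := \dim (fullv : {vspace A}); pose G : 'M[k]_d := \matrix_(i, j) (g (e`_j * e`_i) : k).
pose F : 'rV[k]_d := \row_j (f e`_j : k).
have : (F <= G)%MS.
  rewrite submxE; apply/eqP/rowP => j; rewrite mxE [RHS]mxE.
  (* A column of [cokermx G] holds the coordinates of an [a] with [g (a * y) = 0] for all [y]. *)
  pose w i := cokermx G i j; pose a := \sum_i w i *: e`_i.
  have -> : \sum_i F 0 i * cokermx G i j = f a.
    by rewrite linear_sum; apply: eq_bigr => i _; rewrite linearZ mxE mulrC.
  apply: gf => y; rewrite (eE y) mulr_sumr linear_sum big1 // => l _.
  rewrite -scalerAr linearZ /= mulr_suml linear_sum.
  suff -> : \sum_i g (w i *: e`_i * e`_l) = 0 by apply: mulr0.
  have /matrixP/(_ l j) := mulmx_coker G; rewrite !mxE => GE.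
  rewrite -[RHS]GE; apply: eq_bigr => i _.
  by rewrite -scalerAl linearZ mxE mulrC.
case/submxP => c cE; exists (\sum_i c 0 i *: e`_i) => a.
rewrite (eE a) mulr_suml !linear_sum; apply: eq_bigr => i _.
rewrite -scalerAl !linearZ /=; congr (_ * _).
have /rowP/(_ i) := cE; rewrite !mxE => ->.
rewrite mulr_sumr linear_sum; apply: eq_bigr => l _.
by rewrite -scalerAr linearZ mxE.
Qed.

End LinearForms.

(** * Maximal left ideals and simple modules *)

Section Annihilators.
Variables (k : fieldType) (A : falgType k).
Implicit Types (J K : {vspace A}) (a b c x y : A).

(** Maximality is expressed by saying that every nonzero element of A/J generates A/J. *)
Definition maximal_left_ideal J :=
  [/\ forall a x, x \in J -> a * x \in J, 1 \notin J
    & forall c, c \notin J -> exists a, 1 - a * c \in J].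

Lemma lann_memE x a : (a \in lker (amulr x)) = (a * x == 0).
Proof. by rewrite memv_ker lfunE. Qed.

Lemma lann_maximal x : x != 0 ->
    (forall c, c * x != 0 -> exists a, a * (c * x) = x) ->
  maximal_left_ideal (lker (amulr x)).
Proof.
move=> x0 xmin; split=> [a y|| c]; rewrite !lann_memE.
- by rewrite -mulrA => /eqP->; rewrite mulr0.
- by rewrite mul1r.
move=> /xmin[a aE]; exists a.
by rewrite lann_memE mulrBl -mulrA aE mul1r subrr.
Qed.

Lemma ex_maximal_left_ideal J :
    (forall a x, x \in J -> a * x \in J) -> 1 \notin J ->
  exists2 K, maximal_left_ideal K & (J <= K)%VS.
Proof.
move=> Jl J1; pose D n := `[< exists K, [/\ \dim K = n, (J <= K)%VS, 1 \notin K
  & forall a x, x \in K -> a * x \in K] >].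
have D0 : exists n, D n by exists (\dim J); apply/asboolP; exists J.
have Dmax n : D n -> (n <= dim A)%N.
  by case/asboolP=> K [<- _ _ _]; rewrite -dimvf; apply/dimvS/subvf.
case: (ex_maxnP D0 Dmax) => n /asboolP[K [dimK JK K1 Kl]] Kmax.
exists K => //; split=> // c cK; apply: contrapT => noa.
pose K' := (K + limg (amulr c))%VS.
have memK' x : x \in K' -> exists2 y, y \in K & exists a, x = y + a * c.
  by case/memv_addP=> y yK [_ /memv_imgP[a _ ->] ->]; exists y => //; exists a; rewrite lfunE.
have K'1 : 1 \notin K'.
  by apply/negP => /memK'[y yK [a aE]]; case: noa; exists a; rewrite aE addrK.
have /Kmax : D (\dim K').
  apply/asboolP; exists K'; split=> //; first exact: subv_trans JK (addvSl _ _).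
  move=> a x /memK'[y yK [b ->]]; rewrite mulrDr mulrA; apply: memv_add; first exact: Kl.
  by apply/memv_imgP; exists (a * b); rewrite ?memvf ?lfunE.
rewrite -dimK => le_dim; have /eqP KK' : K == K' by rewrite eqEdim addvSl.
case/negP: cK; rewrite KK' -[c]add0r; apply: memv_add; first exact: mem0v.
by apply/memv_imgP; exists 1; rewrite ?memvf ?lfunE /= ?mul1r.
Qed.

(** Among the nonzero left ideals A(yx), one of least dimension is simple. *)
Lemma ex_minimal_left x : x != 0 ->
  exists2 y, y * x != 0 & maximal_left_ideal (lker (amulr (y * x))).
Proof.
move=> x0; pose D (n : nat) := `[< exists y, y * x != 0 /\ \dim (limg (amulr (y * x))) = n >].
have D0 : exists n, D n.
  by exists (\dim (limg (amulr (1 * x)))); apply/asboolP; exists 1; rewrite mul1r.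
case: (ex_minnP D0) => n /asboolP[y [yx dimy]] ymin.
exists y => //; apply: lann_maximal => // c cyx.
have sub : (limg (amulr (c * (y * x))%R) <= limg (amulr (y * x)%R))%VS.
  apply/subvP => z /memv_imgP[a _ ->]; rewrite lfunE /=.
  by apply/memv_imgP; exists (a * c); rewrite ?memvf ?lfunE /= ?mulrA.
have /eqP E : limg (amulr (c * (y * x))) == limg (amulr (y * x)).
  rewrite eqEdim sub dimy ymin //; apply/asboolP; exists (c * y).
  by rewrite -mulrA.
have : y * x \in limg (amulr (y * x)).
  by apply/memv_imgP; exists 1; rewrite ?memvf ?lfunE /= ?mul1r.
by rewrite -E => /memv_imgP[a _]; rewrite lfunE /=; exists a.
Qed.

(* [c] is the image of 1 under a nonzero homomorphism A/J -> A/K. *)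
Definition quotient_hom J K := exists2 c, c \notin K & forall a, a \in J -> a * c \in K.

(** A nonzero map between simple modules is invertible; [e], a left inverse of [c] modulo [K],
    represents the inverse map. *)
Lemma quotient_hom_sym J K : maximal_left_ideal J -> maximal_left_ideal K ->
  quotient_hom J K -> quotient_hom K J.
Proof.
move=> [Jl J1 Jmax] [Kl K1 Kmax] [c cK Jc].
have acJ a : a * c \in K -> a \in J.
  move=> acK; apply/negPn/negP => /Jmax[b bJ]; case/negP: cK.
  have := memvD (Jc _ bJ) (Kl b _ acK).
  by rewrite mulrBl mul1r mulrA subrK.
have [e eK] := Kmax _ cK; exists e => [|b bK].
  apply/negP => /Jc ec; case/negP: K1.
  by have := memvD eK ec; rewrite subrK.
apply: acJ; have := memvB bK (Kl b _ eK).
by rewrite mulrBr mulr1 opprB addrCA subrr addr0 mulrA.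
Qed.

(** If no A/J_i has a nonzero map to a later A/J_j, each new J_j strictly cuts the intersection of
    the earlier ones, and the dimension of A runs out. *)
Lemma maximal_left_ideals_pigeonhole (J : nat -> {vspace A}) :
  (forall i, maximal_left_ideal (J i)) -> exists i j, (i < j)%N /\ quotient_hom (J i) (J j).
Proof.
move=> Jmax; apply: contrapT => no_hom.
pose K n := (\bigcap_(i < n) J i)%VS.
have KS n : K n.+1 = (K n :&: J n)%VS by rewrite /K big_ord_recr.
have Kl n a x : x \in K n -> a * x \in K n.
  elim: n => [|n IHn]; first by rewrite /K !big_ord0 !memvf.
  rewrite KS !memv_cap => /andP[/IHn-> xJ] /=.
  by have [Jl _ _] := Jmax n; apply: Jl.
(* A simple quotient of A modulo an intersection of J_i receives a nonzero map from some A/J_i. *)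
have KJ n K' : maximal_left_ideal K' -> (K n <= K')%VS ->
    exists2 i, (i < n)%N & quotient_hom (J i) K'.
  move=> [K'l K'1 K'max]; elim: n => [|n IHn] sub.
    by case/negP: K'1; apply: (subvP sub); rewrite /K big_ord0 memvf.
  have [/IHn[i lt_in iK']|not_sub] := boolP (K n <= K')%VS.
    by exists i => //; apply: ltnW.
  exists n => //; have [Jl J1 Jm] := Jmax n.
  have mem_sub x : x \in K n -> x \in J n -> x \in K'.
    by move=> xK xJ; apply: (subvP sub); rewrite KS memv_cap xK.
  have [b bK bK'] : exists2 b, b \in K n & b \notin K'.
    by apply/subvPn.
  have bJ : b \notin J n by apply: contra bK' => /mem_sub; apply.
  (* The element [c] lies in [K n] and is 1 modulo [J n], so multiplying by it keeps [J n] inside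
     [J n]; it avoids [K'] because [b - b * c] lies in [K'] and [b] does not. *)
  have [a aJ] := Jm _ bJ; pose c := a * b; have cK : c \in K n by apply: Kl.
  exists c => [|d dJ]; last first.
    apply: mem_sub; first exact: Kl.
    have := memvB dJ (Jl d _ aJ).
    by rewrite mulrBr mulr1 opprB addrCA subrr addr0.
  apply: contra bK' => cK'.
  have bbc : b - b * c \in K'.
    apply: mem_sub; first by apply: memvB => //; apply: Kl.
    by have := Jl b _ aJ; rewrite mulrBr mulr1.
  by have := memvD bbc (K'l b _ cK'); rewrite subrK.
have dimK n : (\dim (K n) + n <= dim A)%N.
  elim: n => [|n IHn]; first by rewrite addn0 -dimvf; apply/dimvS/subvf.
  apply: leq_trans IHn; rewrite addnS -addSn leq_add2r.
  rewrite ltn_neqAle dimvS ?KS ?capvSl // andbT.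
  apply/negP => dimE; have : (K n <= J n)%VS.
    have /eqP <- : (K n :&: J n)%VS == K n by rewrite eqEdim capvSl (eqP dimE) leqnn.
    exact: capvSr.
  case/(KJ _ _ (Jmax n)) => i lt_in hom; apply: no_hom.
  by exists i, n.
by have := dimK (dim A).+1; rewrite leqNgt ltn_addl.
Qed.

Hypothesis injA : self_injective A.

(** The map ax -> ay of left ideals extends to A by injectivity, and an endomorphism of the left
    module A is a right multiplication. *)
Lemma right_mul_extend x y : (forall a, a * x = 0 -> a * y = 0) -> exists b, x * b = y.
Proof.
move=> xy.
have mulP z : linear (fun a : A^o => (a : A) * z : A^o).
  by move=> a u v; rewrite mulrDl -mulrA.
have [g gE] := injective_factor (u := linear_of (mulP x)) (v := linear_of (mulP y)) injA xy.
exists (g 1); have := gE 1; rewrite /= !mul1r => <-.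
rewrite -[RHS](_ : g (x *: (1 : A^o)) = _); first by rewrite linearZ.
by congr (g _); apply: mulr1.
Qed.

(** If no nonzero [x] kills [I], multiplication by a basis of [I] embeds A in a power of A.
    Injectivity gives a retraction, and applying it to the image of 1 writes 1 as an element of
    [I]. *)
Lemma right_ideal_left_ann (I : {vspace A}) :
    (forall a x, x \in I -> x * a \in I) -> 1 \notin I ->
  exists2 x, x != 0 & forall a, a \in I -> x * a = 0.
Proof.
move=> Ir I1; apply: contrapT => nox; case/negP: I1.
have uP : linear (fun y : A^o => \row_i ((y : A) * (vbasis I)`_i) : 'rV[A]_(\dim I)).
  by move=> a y z; apply/rowP => i; rewrite !mxE mulrDl -mulrA.
have u_inj : injective (linear_of uP).
  apply: raddf_inj => y /rowP y0; apply: contrapT => /eqP ny; apply: nox.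
  exists (y : A) => // a aI; rewrite (coord_vbasis aI) mulr_sumr big1 // => i _.
  by rewrite -scalerAr; have := y0 i; rewrite !mxE => ->; rewrite scaler0.
have [g gE] := injA (i := linear_of uP) idfun u_inj.
have <- : g (linear_of uP (1 : A)) = 1 := gE 1.
rewrite (row_sum_delta (linear_of uP (1 : A))) linear_sum; apply: memv_suml => i _.
rewrite linearZ /= mxE mul1r; apply: Ir.
by rewrite vbasis_mem // mem_nth // size_tuple.
Qed.

(** Under the right action (f a)(y) = f (a y) on linear forms, this is the annihilator of [f], a
    right ideal. *)
Definition form_ann (f : {linear A -> k^o}) a := forall y, f (a * y) = 0.

(** The right module generated by [f] is the dual of A/J, hence simple. So the annihilator of [f] is
    a maximal right ideal, and the proper right annihilator of [w] cannot exceed it. *)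
Lemma form_ann_maximal J (f : {linear A -> k^o}) w :
    maximal_left_ideal J -> (forall a, a \in J -> f a = 0) -> w != 0 ->
    (forall a, form_ann f a -> w * a = 0) ->
  forall a, w * a = 0 -> form_ann f a.
Proof.
move=> [Jl J1 Jmax] fJ w0 fw a wa y.
have kerE b : (b \in lker (amull w)) = (w * b == 0) by rewrite memv_ker lfunE.
(* The form [h] kills the right annihilator of [w] but not 1. It equals [f (_ * c)], which puts [c]
   outside [J], so [c] has a left inverse modulo [J]. *)
have [|h hw h1] := @separating_form _ A (lker (amull w)) 1; first by rewrite kerE mulr1.
have [|c cE] := @form_factor _ A f h.
  by move=> b /fw wb; apply: hw; rewrite kerE wb.
have [|d dJ] := Jmax c.
  by apply: contra h1 => /fJ fc; rewrite -cE mul1r fc.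
have -> : a * y = a * y * d * c + a * y * (1 - d * c).
  by rewrite mulrBr mulr1 addrC mulrA subrK.
rewrite linearD cE hw; last by rewrite kerE !mulrA wa !mul0r.
by rewrite fJ ?addr0 //; apply: Jl.
Qed.

(* The right ideal xA is isomorphic to the k-dual of the simple module A/J, which is
   generated by [f]; the left ideal Ax is simple as well. *)
Definition dual_generator J (f : {linear A -> k^o}) x :=
  [/\ forall a, a \in J -> f a = 0, f 1 != 0,
      forall a, form_ann f a -> x * a = 0, x != 0
    & maximal_left_ideal (lker (amulr x))].

(** The annihilator of [f] is a proper right ideal, so some nonzero [x] kills it; a left multiple of
    [x] that generates a simple left ideal still does. *)
Lemma ex_dual_generator J : maximal_left_ideal J -> exists f x, dual_generator J f x.
Proof.
move=> [_ J1 _]; have [f fJ f1] := separating_form J1.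
have [||I IE] := @vspace_of_pred _ _ (form_ann f).
- by move=> y; rewrite mul0r linear0.
- by move=> a u v fu fv y; rewrite mulrDl -scalerAl linearP fu fv scaler0 addr0.
have [||x x0 xI] := @right_ideal_left_ann I.
- by move=> a y /IE fy; apply/IE => z; rewrite -mulrA.
- by apply/negP => /IE/(_ 1); rewrite mulr1; apply/eqP.
have [y yx ymax] := ex_minimal_left x0.
exists f, (y * x); split=> // a /IE/xI xa.
by rewrite -mulrA xa mulr0.
Qed.

(** An isomorphism of the left ideals A x1 and A x2 yields one between the right ideals x1 A and x2
    A. These are dual to A/J1 and A/J2, and dualizing gives the claim. *)
Lemma dual_generator_hom J1 J2 (f1 f2 : {linear A -> k^o}) x1 x2 :
    maximal_left_ideal J1 -> maximal_left_ideal J2 ->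
    dual_generator J1 f1 x1 -> dual_generator J2 f2 x2 ->
    quotient_hom (lker (amulr x1)) (lker (amulr x2)) ->
  quotient_hom J2 J1.
Proof.
move=> max1 max2 [fJ1 f11 fx1 _ _] [fJ2 f21 fx2 _ _] [c].
rewrite lann_memE => cx2 x12.
(* The map A x1 -> A x2 sending [x1] to [c * x2] is right multiplication by [b]. *)
have [a|b bE] := @right_mul_extend x1 (c * x2).
  by move=> ax1; apply/eqP; rewrite mulrA -lann_memE x12 // lann_memE ax1.
have gP : linear (fun a => f1 (b * a)).
  by move=> a u v; rewrite mulrDr -scalerAr linearP.
(* Whatever annihilates the form [f1 (b * _)] annihilates [x1 * b = c * x2], hence also [f2]; so
   [f2] is [f1 (b * (_ * c'))]. *)
have [a fba|c' c'E] := @form_factor _ A (linear_of gP) f2.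
  rewrite -[a]mulr1; apply: (form_ann_maximal max2 fJ2 cx2).
    by move=> d /fx2 xd; rewrite -mulrA xd mulr0.
  by rewrite -bE -mulrA fx1 // => y; rewrite -mulrA; apply: fba.
have [J1l J11 J1max] := max1.
have fb y : (forall z, f1 (b * (z * y)) = 0) -> y \in J1.
  move=> fy; apply/negPn/negP => /J1max[d dJ]; case/negP: cx2.
  rewrite -bE fx1 // => z.
  have -> : b * z = b * (z * d * y) + b * z * (1 - d * y).
    by rewrite mulrBr mulr1 addrC !mulrA subrK.
  by rewrite linearD fy add0r fJ1 //; apply: J1l.
have /= {}c'E := c'E; exists c' => [|a aJ].
  by apply: contra f21 => /(J1l b)/fJ1 fbc; rewrite -c'E mul1r fbc.
apply: fb => z; rewrite (mulrA z) c'E; apply: fJ2.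
by have [J2l _ _] := max2; apply: J2l.
Qed.

(* Iterating J |-> lann(x_J) comes back to A/J up to isomorphism, as this map is injective
   on the finitely many isomorphism classes of simple modules. *)
Lemma maximal_left_ideal_right_ann J : maximal_left_ideal J ->
  exists2 y, y != 0 & forall a, a \in J -> a * y = 0.
Proof.
move=> Jmax.
have /choice[x xP] K : exists x, maximal_left_ideal K -> exists f, dual_generator K f x.
  have [/ex_dual_generator[f [x fx]]|nK] := EM (maximal_left_ideal K).
    by exists x => _; exists f.
  by exists 0.
pose nu K := lker (amulr (x K)).
have nu_max K : maximal_left_ideal K -> maximal_left_ideal (nu K).
  by move=> /xP[f []].
have iter_max i : maximal_left_ideal (iter i nu J) by elim: i => //= i; apply: nu_max.
have [i [j [lt_ij hom]]] := maximal_left_ideals_pigeonhole iter_max.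
elim: i j lt_ij hom => [|i IHi] [|j] // lt_ij hom; last first.
  apply: (IHi j) => //; apply: quotient_hom_sym => //.
  have [f fx] := xP _ (iter_max i); have [f' fx'] := xP _ (iter_max j).
  exact: dual_generator_hom fx fx' hom.
case: hom => c; rewrite /= lann_memE => cx Jc.
exists (c * x (iter j nu J)) => // a /Jc; rewrite lann_memE mulrA.
by move/eqP.
Qed.

(** The cyclic module A m has a simple quotient A/J, which embeds in A by sending 1 to [y];
    injectivity extends the composite to [M]. *)
Lemma regular_cogenerator (M : lmodType A) (m : M) : m != 0 ->
  exists h : {linear M -> A^o}, h m != 0.
Proof.
move=> m0; have [||K KE] := @vspace_of_pred _ _ (fun a : A => a *: m = 0).
- exact: scale0r.
- by move=> a u v um vm; rewrite scalerDl vm addr0 -[u]mul1r scalerAl -scalerA um scaler0.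
have [||J Jmax KJ] := @ex_maximal_left_ideal K.
- by move=> a x /KE xm; apply/KE; rewrite -scalerA xm scaler0.
- by apply/negP => /KE; rewrite scale1r; apply/eqP.
have [y y0 Jy] := maximal_left_ideal_right_ann Jmax.
have uP : linear (fun a : A^o => (a : A) *: m).
  by move=> a u v; rewrite scalerDl scalerA.
have vP : linear (fun a : A^o => (a : A) * y : A^o).
  by move=> a u v; rewrite mulrDl -mulrA.
have [a am|h hE] := injective_factor (u := linear_of uP) (v := linear_of vP) injA.
  by apply: Jy; apply: (subvP KJ); apply/KE.
by exists h; have := hE 1; rewrite /= scale1r mul1r => ->.
Qed.

(** A k-basis of Hom(M, A), finite because a homomorphism is determined by its values on generators,
    separates points by [regular_cogenerator]; its members are the components of an embedding in a
    power of A. *)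
Lemma projective_embedding (M : lmodType A) : finite_dim M ->
  exists P : lmodType A, [/\ finite_dim P, projective_module P, injective_module P
    & exists j : {linear M -> P}, injective j].
Proof.
move=> [n [s sP]].
pose S (v : {ffun 'I_n -> A}) :=
  exists h : {linear M -> A^o}, forall i, h (s i) = v i :> A.
have [||U US] := @vspace_of_pred _ _ S.
- by exists \0 => i; rewrite ffunE.
- move=> a u v [f fE] [g gE].
  have hP : linear (fun x : M => (a *: (f x : A) + (g x : A)) : A^o).
    move=> b x y; rewrite !linearP.
    change (a *: (b * (f x : A) + (f y : A)) + (b * (g x : A) + (g y : A))
      = b * (a *: (f x : A) + (g x : A)) + (a *: (f y : A) + (g y : A))).
    by rewrite scalerDr mulrDr scalerAr addrACA.
  by exists (linear_of hP) => i; rewrite /= !ffunE fE gE.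
have /choice[h hE] (i : 'I_(\dim U)) : S (tnth (vbasis U) i).
  by apply/US/vbasis_mem/mem_tnth.
have h_sep (x : M) : (forall i, h i x = 0) -> x = 0.
  move=> hx; apply: contrapT => /eqP/regular_cogenerator[f /negP]; apply; apply/eqP.
  pose v := [ffun i => f (s i) : A].
  have vU : v \in U by apply/US; exists f => i; rewrite ffunE.
  have fE i : f (s i) = \sum_l coord (vbasis U) l v *: (h l (s i) : A) :> A.
    have -> : f (s i) = v i by rewrite ffunE.
    rewrite {1}(coord_vbasis vU) sum_ffunE; apply: eq_bigr => l _.
    by rewrite ffunE -(tnth_nth 0) hE.
  have [c cE] := sP x.
  have lin (f' : {linear M -> A^o}) : f' x = \sum_i c i *: (f' (s i) : A) :> A.
    rewrite cE linear_sum; apply: eq_bigr => i _; rewrite linearZ.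
    by rewrite -[LHS]scalerAl mul1r.
  rewrite lin; under eq_bigr do rewrite fE scaler_sumr.
  rewrite exchange_big big1 //= => l _.
  under eq_bigr do rewrite scalerA mulrC -scalerA.
  by rewrite -scaler_sumr -lin hx scaler0.
suff [P [fdP projP injP [j jh]]] : exists P : lmodType A,
    [/\ finite_dim P, projective_module P, injective_module P
    & exists j : {linear M -> P}, forall x : M, j x = 0 -> forall i, h i x = 0].
  by exists P; split=> //; exists j; apply: raddf_inj => x /jh/h_sep.
elim: (\dim U) h {h_sep hE} => [|d IHd] h.
  exists 'rV[A]_0; split; [exact: finite_dim0 | exact: projective0 | exact: injective0 |].
  by exists \0 => x _ [].
have [P [fdP projP injP [j jh]]] := IHd (fun i => h (lift ord0 i)).
exists (P * A^o)%type; split.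
- exact: finite_dim_pair fdP (finite_dim_regular A).
- apply: projective_pair projP _; exact: regular_projective.
- exact: injective_pair injP injA.
have lP : linear (fun x : M => (j x, h ord0 x)) by move=> a x y; rewrite !linearP.
exists (linear_of lP) => x [jx hx] i.
by case: (unliftP ord0 i) => [l ->|->]; first exact: jh.
Qed.

End Annihilators.

(** * Stable monomorphisms and epimorphisms *)

Section StableCategory.
Variables (k : fieldType) (A : falgType k).

(** The map is a bare function, so that sums and composites written pointwise need no bundled linear
    structure. *)
Definition stably_zero (M N : lmodType A) (f : M -> N) : Prop :=
  exists (P : lmodType A) (u : {linear M -> P}) (v : {linear P -> N}),
    [/\ finite_dim P, projective_module P & forall x, f x = v (u x)].

Lemma stably_zero_ext (M N : lmodType A) (f g : M -> N) :
  (forall x, f x = g x) -> stably_zero f -> stably_zero g.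
Proof.
by move=> fg [P [u [v [fdP projP fE]]]]; exists P, u, v; split=> // x; rewrite -fg.
Qed.

Lemma stably_zeroD (M N : lmodType A) (f g : M -> N) :
  stably_zero f -> stably_zero g -> stably_zero (fun x => f x + g x).
Proof.
move=> [P [u [v [fdP projP fE]]]] [Q [r [s [fdQ projQ gE]]]].
have urP : linear (fun x => (u x, r x)) by move=> a x y; rewrite !linearP.
exists (P * Q)%type, (linear_of urP), ((v \o fst) \+ (s \o snd) : {linear _ -> _}).
split; [exact: finite_dim_pair | exact: projective_pair |].
by move=> x /=; rewrite fE gE.
Qed.

Definition stable_mono (M N : lmodType A) (f : {linear M -> N}) :=
  forall (W : lmodType A) (a : {linear W -> M}), finite_dim W ->
  stably_zero (fun x => f (a x)) -> stably_zero a.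

Definition stable_epi (M N : lmodType A) (f : {linear M -> N}) :=
  forall (W : lmodType A) (a : {linear N -> W}), finite_dim W ->
  stably_zero (fun x => a (f x)) -> stably_zero a.

Definition stably_injective (Z : lmodType A) :=
  forall (M N : lmodType A) (f : {linear M -> N}) (a : {linear M -> Z}),
  finite_dim M -> finite_dim N -> stable_mono f ->
  exists b : {linear N -> Z}, stably_zero (fun x => b (f x) - a x).

Definition stably_projective (Z : lmodType A) :=
  forall (M N : lmodType A) (f : {linear M -> N}) (a : {linear Z -> N}),
  finite_dim M -> finite_dim N -> stable_epi f ->
  exists b : {linear Z -> M}, stably_zero (fun z => f (b z) - a z).

(** A cover [P] of [N] makes [f] onto; let K be the kernel of M + P -> N. As [f] is a stable
    monomorphism, K -> M factors through a projective. Hence [a] on K lifts to [Q], and the lift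
    extends to M + P by injectivity; subtracting it leaves a map that descends to [N]. *)
Lemma stably_injective_quotient (Q Z : lmodType A) (p : {linear Q -> Z}) :
    finite_dim Q -> projective_module Q -> injective_module Q ->
    (forall z, exists y, p y = z) ->
  stably_injective Z.
Proof.
move=> fdQ projQ injQ p_surj M N f a fdM fdN f_mono.
have [P [fdP projP _ [q q_surj]]] := projective_cover fdN.
pose u : {linear (M * P)%type -> N} := (f \o fst) \+ (q \o snd).
have u_surj y : exists x, u x = y.
  by have [x <-] := q_surj y; exists (0, x); rewrite /= linear0 add0r.
pose i := kerm_inj u.
have [||T [r [s [fdT projT rsE]]]] := f_mono _ (fst \o i : {linear kerm u -> M}).
- exact: finite_dim_inj (@kerm_injI _ _ _ u) (finite_dim_pair fdM fdP).
- exists P, (snd \o i : {linear _ -> _}), (\- q : {linear _ -> _}); split=> // x /=.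
  by apply/eqP; rewrite -addr_eq0; apply/eqP; apply: (kermE x).
have [t tE] := projT _ _ p (a \o s) p_surj.
have [e eE] := injQ _ _ i (t \o r) (@kerm_injI _ _ _ u).
have [|b bE] := factor_surj (u := u) (v := (a \o fst) \- (p \o e)) u_surj.
  move=> x /kerm_ex[x' <-]; apply/eqP; rewrite subr_eq0; apply/eqP.
  have /= := rsE x'; rewrite -/i => ->.
  by rewrite eE tE.
exists b, Q, (e \o @modinl _ _ M P : {linear _ -> _}), (\- p : {linear _ -> _}); split=> // x /=.
have := bE (modinl P x); rewrite /= linear0 addr0 => ->.
by rewrite addrC addKr.
Qed.

(** Dual argument, with the cokernel of M -> N + P. The map [c] has to detect only the images of the
    kernel of [p]: this is what makes the lift Q -> M descend to [Z]. *)
Lemma stably_projective_quotient (Q Z : lmodType A) (p : {linear Q -> Z}) :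
    projective_module Q -> (forall z, exists y, p y = z) ->
    (forall M : lmodType A, finite_dim M ->
      exists (P : lmodType A) (c : {linear M -> P}), [/\ finite_dim P, projective_module P
      & forall (m : {linear Q -> M}) y, p y = 0 -> c (m y) = 0 -> m y = 0]) ->
  stably_projective Z.
Proof.
move=> projQ p_surj coverP M N g h fdM fdN g_epi.
have [P [c [fdP projP cE]]] := coverP M fdM.
have gcP : linear (fun x => (g x, c x)) by move=> a x y; rewrite !linearP.
pose gc : {linear M -> (N * P)%type} := linear_of gcP.
pose q : {linear (N * P)%type -> cokerm gc} := cokerm_pi gc.
have q_surj : forall y, exists x, q x = y := @cokerm_pi_surj _ _ _ _.
have q0 x : q x = 0 <-> exists y, gc y = x := cokerm_pi_eq0 _ _.
have [||T [r [s [fdT projT rsE]]]] := g_epi _ (q \o @modinl _ _ N P : {linear N -> cokerm gc}).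
- exact: finite_dim_surj q_surj (finite_dim_pair fdN fdP).
- exists P, c, (\- (q \o @modinr _ _ N P) : {linear _ -> _}); split=> // x /=.
  apply/eqP; rewrite -addr_eq0 -linearD; apply/eqP/q0; exists x.
  by congr pair; rewrite /= ?addr0 ?add0r.
have [t tE] := projT _ _ q s q_surj.
pose i := kerm_inj q.
(* The corrected map [d] lands in the kernel of [q], which is the image of [gc], so projectivity of
   [Q] lifts it to [M]. *)
pose d : {linear Q -> (N * P)%type} := (@modinl _ _ N P \- (t \o r)) \o (h \o p).
have [|d' d'E] := @factor_inj _ _ _ _ i d (@kerm_injI _ _ _ q).
  move=> y; apply: kerm_ex; rewrite /d /= linearB tE.
  by have /= -> := rsE (h (p y)); rewrite subrr.
have [|gc' gc'E] := @factor_inj _ _ _ _ i gc (@kerm_injI _ _ _ q).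
  by move=> x; apply: kerm_ex; apply/q0; exists x.
have [|m mE] := projQ _ _ gc' d'.
  move=> y; have /q0[x xE] := kermE y; exists x; apply: (@kerm_injI _ _ _ q).
  by rewrite -/i gc'E.
have {}mE y : gc (m y) = d y by rewrite -gc'E mE d'E.
have [|b bE] := factor_surj (u := p) (v := m) p_surj.
  move=> y py; apply: cE => //; have := mE y; rewrite /d /= py !linear0 addr0.
  by case.
exists b, T, (r \o h : {linear _ -> _}), (\- (fst \o t) : {linear _ -> _}); split=> // z /=.
have [y <-] := p_surj z; rewrite bE; have := mE y; rewrite /d /=.
by case=> -> _; rewrite addrC addKr.
Qed.

End StableCategory.

(** * Modules over T_2(A) *)

Section T2Modules.
Variables (k : fieldType) (A : falgType k).
Implicit Types (a b c : A).

Definition t2mx a b c : T2 A := t2_of_entries (a, b, c).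

Lemma t2mx_ex (t : T2 A) : exists a b c, t = t2mx a b c.
Proof.
exists (t2_entries t).1.1, (t2_entries t).1.2, (t2_entries t).2.
by rewrite /t2mx -!surjective_pairing t2_entriesK.
Qed.

Lemma t2mxP (s t : T2 A) :
  t2val s 0 0 = t2val t 0 0 -> t2val s 1 0 = t2val t 1 0 -> t2val s 1 1 = t2val t 1 1 -> s = t.
Proof.
by move=> e00 e10 e11; rewrite -[s]t2_entriesK -[t]t2_entriesK /t2_entries e00 e10 e11.
Qed.

Lemma t2mxM a b c a' b' c' :
  t2mx a b c * t2mx a' b' c' = t2mx (a * a') (b * a' + c * b') (c * c').
Proof.
have l1 : lift ord0 ord0 = 1 :> 'I_2 by apply: val_inj.
by apply: t2mxP; rewrite /= !mxE !big_ord_recl big_ord0 /= !mxE ?l1 /=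
   ?mul0r ?mulr0 ?addr0 ?add0r.
Qed.

Lemma t2mxD a b c a' b' c' :
  t2mx a b c + t2mx a' b' c' = t2mx (a + a') (b + b') (c + c').
Proof. by apply: t2mxP; rewrite /= !mxE. Qed.

Lemma t2mx1 : t2mx 1 0 1 = 1.
Proof. by apply: t2mxP; rewrite /= !mxE. Qed.

Lemma t2mxZ (d : k) : d%:A = t2mx d%:A 0 d%:A.
Proof. by apply: t2mxP; rewrite /= !mxE /= ?scaler0. Qed.

Lemma t2mx0 : t2mx 0 0 0 = 0.
Proof. by apply: t2mxP; rewrite /= !mxE. Qed.

Definition t2simp := (@mul0r A, @mulr0 A, @addr0 A, @add0r A, @mul1r A, @mulr1 A, t2mx0,
  fun Z : lmodType (T2 A) => @scale0r (T2 A) Z).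

(* The restriction of a T2(A)-module along the diagonal embedding of A. *)
Definition res (Z : lmodType (T2 A)) : Type := Z.

Section Restriction.
Variable Z : lmodType (T2 A).

HB.instance Definition _ := GRing.Zmodule.on (res Z).

Definition res_scale a (z : res Z) : res Z := t2mx a 0 a *: (z : Z).

Fact res_scaleA a b z : res_scale a (res_scale b z) = res_scale (a * b) z.
Proof. by rewrite /res_scale scalerA t2mxM mulr0 mul0r addr0. Qed.
Fact res_scale1 : left_id 1 res_scale.
Proof. by move=> z; rewrite /res_scale t2mx1 scale1r. Qed.
Fact res_scaleDr : right_distributive res_scale +%R.
Proof. by move=> a y z; apply: scalerDr. Qed.
Fact res_scaleDl z : {morph res_scale^~ z : a b / a + b}.
Proof. by move=> a b; rewrite /res_scale -scalerDl t2mxD addr0. Qed.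

HB.instance Definition _ := GRing.Zmodule_isLmodule.Build A (res Z)
  res_scaleA res_scale1 res_scaleDr res_scaleDl.

Lemma res_scaleE a (z : res Z) : a *: z = t2mx a 0 a *: (z : Z) :> Z.
Proof. by []. Qed.

(** For Z = (X -> Y), with restriction X + Y, [idem1] and [idem2] project onto X and Y, and [arrow]
    is the structure map extended by zero. *)
Definition idem1_fun (z : res Z) : res Z := t2mx 1 0 0 *: (z : Z).
Definition idem2_fun (z : res Z) : res Z := t2mx 0 0 1 *: (z : Z).
Definition arrow_fun (z : res Z) : res Z := t2mx 0 1 0 *: (z : Z).

Fact idem1_linear : linear idem1_fun.
Proof.
move=> a y z; rewrite /idem1_fun scalerDr; congr (_ + _).
by rewrite res_scaleE [RHS]res_scaleE !scalerA !t2mxM !(mul0r, mulr0, addr0, mul1r, mulr1).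
Qed.
Fact idem2_linear : linear idem2_fun.
Proof.
move=> a y z; rewrite /idem2_fun scalerDr; congr (_ + _).
by rewrite res_scaleE [RHS]res_scaleE !scalerA !t2mxM !(mul0r, mulr0, addr0, mul1r, mulr1).
Qed.
Fact arrow_linear : linear arrow_fun.
Proof.
move=> a y z; rewrite /arrow_fun scalerDr; congr (_ + _).
by rewrite res_scaleE [RHS]res_scaleE !scalerA !t2mxM !(mul0r, mulr0, addr0, add0r, mul1r, mulr1).
Qed.

Definition idem1 : {linear res Z -> res Z} := locked (linear_of idem1_linear).
Definition idem2 : {linear res Z -> res Z} := locked (linear_of idem2_linear).
Definition arrow : {linear res Z -> res Z} := locked (linear_of arrow_linear).

Lemma idem1E z : idem1 z = t2mx 1 0 0 *: (z : Z) :> Z. Proof. by rewrite /idem1 -lock. Qed.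
Lemma idem2E z : idem2 z = t2mx 0 0 1 *: (z : Z) :> Z. Proof. by rewrite /idem2 -lock. Qed.
Lemma arrowE z : arrow z = t2mx 0 1 0 *: (z : Z) :> Z. Proof. by rewrite /arrow -lock. Qed.

Lemma idem11 z : idem1 (idem1 z) = idem1 z.
Proof. by rewrite !(idem1E, idem2E, arrowE) scalerA t2mxM !t2simp. Qed.
Lemma idem22 z : idem2 (idem2 z) = idem2 z.
Proof. by rewrite !(idem1E, idem2E, arrowE) scalerA t2mxM !t2simp. Qed.
Lemma idem12 z : idem1 (idem2 z) = 0.
Proof. by rewrite !(idem1E, idem2E, arrowE) scalerA t2mxM !t2simp. Qed.
Lemma idem21 z : idem2 (idem1 z) = 0.
Proof. by rewrite !(idem1E, idem2E, arrowE) scalerA t2mxM !t2simp. Qed.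
Lemma arrow1 z : arrow (idem1 z) = arrow z.
Proof. by rewrite !(idem1E, idem2E, arrowE) scalerA t2mxM !t2simp. Qed.
Lemma arrow2 z : arrow (idem2 z) = 0.
Proof. by rewrite !(idem1E, idem2E, arrowE) scalerA t2mxM !t2simp. Qed.
Lemma idem1_arrow z : idem1 (arrow z) = 0.
Proof. by rewrite !(idem1E, idem2E, arrowE) scalerA t2mxM !t2simp. Qed.
Lemma idem2_arrow z : idem2 (arrow z) = arrow z.
Proof. by rewrite !(idem1E, idem2E, arrowE) scalerA t2mxM !t2simp. Qed.
Lemma arrow_arrow z : arrow (arrow z) = 0.
Proof. by rewrite !(idem1E, idem2E, arrowE) scalerA t2mxM !t2simp. Qed.

Definition t2actE := (idem11, idem22, idem12, idem21, arrow1, arrow2, idem1_arrow,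
  idem2_arrow, arrow_arrow).

Lemma idem_sum z : idem1 z + idem2 z = z.
Proof.
have := scalerDl (z : Z) (t2mx 1 0 0) (t2mx 0 0 1).
by rewrite t2mxD !t2simp t2mx1 scale1r idem1E idem2E => /esym.
Qed.

Lemma t2mx_act a b c (z : res Z) :
  t2mx a b c *: (z : Z) = a *: idem1 z + b *: arrow z + c *: idem2 z :> res Z.
Proof.
have -> : t2mx a b c = t2mx a 0 0 + t2mx 0 b 0 + t2mx 0 0 c by rewrite !t2mxD !t2simp.
rewrite !scalerDl; congr (_ + _ + _);
  by rewrite res_scaleE ?(idem1E, idem2E, arrowE) scalerA t2mxM !t2simp.
Qed.

Lemma finite_dim_res : finite_dim Z <-> finite_dim (res Z : lmodType A).
Proof.
split=> -[n [s sP]]; exists n, s => z; have [c cE] := sP z; exists c; rewrite [LHS]cE;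
  by apply: eq_bigr => i _; rewrite res_scaleE t2mxZ.
Qed.

End Restriction.

Section RestrictionMaps.
Variables Y Z : lmodType (T2 A).

Fact resl_subproof (f : {linear Y -> Z}) : linear (f : res Y -> res Z).
Proof. by move=> a x y; rewrite res_scaleE linearP. Qed.
Definition resl (f : {linear Y -> Z}) : {linear res Y -> res Z} :=
  linear_of (resl_subproof f).

Lemma resl_idem1 (f : {linear Y -> Z}) (y : res Y) : f (idem1 Y y) = idem1 Z (f y).
Proof. by rewrite !idem1E; apply: linearZ. Qed.
Lemma resl_idem2 (f : {linear Y -> Z}) (y : res Y) : f (idem2 Y y) = idem2 Z (f y).
Proof. by rewrite !idem2E; apply: linearZ. Qed.
Lemma resl_arrow (f : {linear Y -> Z}) (y : res Y) : f (arrow Y y) = arrow Z (f y).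
Proof. by rewrite !arrowE; apply: linearZ. Qed.

Variable f : {linear res Y -> res Z}.
Hypotheses (f1 : forall y, f (idem1 Y y) = idem1 Z (f y))
  (f21 : forall y, f (arrow Y y) = arrow Z (f y)).

Fact t2_linear_subproof : linear (f : Y -> Z).
Proof.
have f2 y : f (idem2 Y y) = idem2 Z (f y).
  apply: (addrI (idem1 Z (f y))); rewrite idem_sum -f1.
  by rewrite -[LHS](linearD f) idem_sum.
move=> t x y; rewrite [LHS](linearD f); congr (_ + _).
have [a [b [c ->]]] := t2mx_ex t.
rewrite !t2mx_act !(linearD f); congr (_ + _ + _).
- by rewrite [LHS]linearZ f1.
- by rewrite [LHS]linearZ f21.
- by rewrite [LHS]linearZ f2.
Qed.
Definition t2_linear : {linear Y -> Z} := linear_of t2_linear_subproof.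

End RestrictionMaps.

Definition t2rep (X Y : lmodType A) (phi : {linear X -> Y}) : Type := (X * Y)%type.

Section Representations.
Variables (X Y : lmodType A) (phi : {linear X -> Y}).
Local Notation t2rep := (t2rep phi).

HB.instance Definition _ := GRing.Zmodule.on t2rep.

Definition t2rep_scale (t : T2 A) (z : t2rep) : t2rep :=
  (t2val t 0 0 *: z.1, t2val t 1 0 *: phi z.1 + t2val t 1 1 *: z.2).

Lemma t2rep_scaleE a b c z :
  t2rep_scale (t2mx a b c) z = (a *: z.1, b *: phi z.1 + c *: z.2).
Proof. by rewrite /t2rep_scale /= !mxE. Qed.

Fact t2rep_scaleA s t z : t2rep_scale s (t2rep_scale t z) = t2rep_scale (s * t) z.
Proof.
have [a [b [c ->]]] := t2mx_ex s; have [a' [b' [c' ->]]] := t2mx_ex t.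
rewrite t2mxM !t2rep_scaleE /= linearZ /= !scalerDr !scalerA.
by rewrite scalerDl addrA.
Qed.
Fact t2rep_scale1 : left_id 1 t2rep_scale.
Proof.
by case=> x y; rewrite -t2mx1 t2rep_scaleE !scale1r scale0r add0r.
Qed.
Fact t2rep_scaleDr : right_distributive t2rep_scale +%R.
Proof.
move=> t x y; rewrite /t2rep_scale /= !linearD /= !scalerDr.
by congr pair; rewrite addrACA.
Qed.
Fact t2rep_scaleDl z : {morph t2rep_scale^~ z : s t / s + t}.
Proof.
move=> s t; have [a [b [c ->]]] := t2mx_ex s; have [a' [b' [c' ->]]] := t2mx_ex t.
rewrite t2mxD !t2rep_scaleE !scalerDl.
by congr pair; rewrite addrACA.
Qed.

HB.instance Definition _ := GRing.Zmodule_isLmodule.Build (T2 A) t2rep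
  t2rep_scaleA t2rep_scale1 t2rep_scaleDr t2rep_scaleDl.

Lemma t2repE a b c (z : t2rep) : t2mx a b c *: z = (a *: z.1, b *: phi z.1 + c *: z.2).
Proof. exact: t2rep_scaleE. Qed.

Lemma t2rep_res a (z : res t2rep) : a *: z = (a *: z.1, a *: z.2).
Proof. by rewrite res_scaleE t2repE scale0r add0r. Qed.

Lemma t2rep_idem1 (z : res t2rep) : idem1 t2rep z = (z.1, 0).
Proof. by rewrite idem1E t2repE !scale0r scale1r addr0. Qed.
Lemma t2rep_idem2 (z : res t2rep) : idem2 t2rep z = (0, z.2).
Proof. by rewrite idem2E t2repE !scale0r scale1r add0r. Qed.
Lemma t2rep_arrow (z : res t2rep) : arrow t2rep z = (0, phi z.1).
Proof. by rewrite arrowE t2repE !scale0r scale1r addr0. Qed.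

Fact t2fst_linear : linear (fun z : res t2rep => z.1).
Proof. by move=> a y z; rewrite t2rep_res. Qed.
Fact t2snd_linear : linear (fun z : res t2rep => z.2).
Proof. by move=> a y z; rewrite t2rep_res. Qed.
Fact t2in1_linear : linear (fun x => (x, 0) : res t2rep).
Proof. by move=> a x y; rewrite t2rep_res; congr pair; rewrite /= scaler0 addr0. Qed.
Fact t2in2_linear : linear (fun y => (0, y) : res t2rep).
Proof. by move=> a x y; rewrite t2rep_res; congr pair; rewrite /= scaler0 addr0. Qed.
Definition t2fst : {linear res t2rep -> X} := linear_of t2fst_linear.
Definition t2snd : {linear res t2rep -> Y} := linear_of t2snd_linear.
Definition t2in1 : {linear X -> res t2rep} := linear_of t2in1_linear.
Definition t2in2 : {linear Y -> res t2rep} := linear_of t2in2_linear.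

Lemma finite_dim_t2rep : finite_dim X -> finite_dim Y -> finite_dim (t2rep : lmodType (T2 A)).
Proof.
move=> fdX fdY; have [n [s sP]] := finite_dim_pair fdX fdY.
exists n, s => z; have [c cE] := sP z; exists c; rewrite [LHS]cE.
apply: eq_bigr => i _; rewrite t2mxZ t2repE scale0r add0r.
by case: (s i).
Qed.

End Representations.
End T2Modules.

Arguments idem1 {k A} Z.
Arguments idem2 {k A} Z.
Arguments arrow {k A} Z.

(** * The modules P = P and 0 -> P, and projective T_2(A)-modules *)

Section T2Projectives.
Variables (k : fieldType) (A : falgType k).

Definition idrep (P : lmodType A) : lmodType (T2 A) := t2rep (idfun : {linear P -> P}).
Definition botrep (S : lmodType A) : lmodType (T2 A) :=
  t2rep (\0 : {linear 'rV[A]_0 -> S}).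

Lemma finite_dim_idrep P : finite_dim P -> finite_dim (idrep P).
Proof. by move=> fdP; apply: finite_dim_t2rep. Qed.

Lemma finite_dim_botrep S : finite_dim S -> finite_dim (botrep S).
Proof. exact/finite_dim_t2rep/finite_dim0. Qed.

Section RepresentationMaps.
Variables (Z : lmodType (T2 A)) (P : lmodType A).

Section ToIdrep.
Variable c : {linear res Z -> P}.
Fact to_idrep_linear : linear (fun z : res Z => (c (arrow Z z), c (idem2 Z z)) : res (idrep P)).
Proof. by move=> a y z; rewrite t2rep_res !linearP. Qed.
Fact to_idrep1 z : linear_of to_idrep_linear (idem1 Z z) = idem1 _ (linear_of to_idrep_linear z).
Proof. by rewrite t2rep_idem1 /= !t2actE linear0. Qed.
Fact to_idrep21 z : linear_of to_idrep_linear (arrow Z z) = arrow _ (linear_of to_idrep_linear z).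
Proof. by rewrite t2rep_arrow /= !t2actE linear0. Qed.
(** Maps from X -> Y to P = P correspond to maps Y -> P; [c] is given on all of Z so that Y need not
    be formed. *)
Definition to_idrep : {linear Z -> idrep P} := t2_linear to_idrep1 to_idrep21.
Lemma to_idrepE z : to_idrep z = (c (arrow Z z), c (idem2 Z z)).
Proof. by []. Qed.
End ToIdrep.

Section FromIdrep.
Variable b : {linear P -> res Z}.
Fact from_idrep_linear :
  linear (fun z : res (idrep P) => idem1 Z (b z.1) + arrow Z (b z.2)).
Proof. by move=> a y z; rewrite t2rep_res !linearP /= scalerDr addrACA. Qed.
Fact from_idrep1 z :
  linear_of from_idrep_linear (idem1 _ z) = idem1 Z (linear_of from_idrep_linear z).
Proof. by rewrite t2rep_idem1 /= linearD !t2actE !linear0. Qed.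
Fact from_idrep21 z :
  linear_of from_idrep_linear (arrow _ z) = arrow Z (linear_of from_idrep_linear z).
Proof. by rewrite t2rep_arrow /= linearD !t2actE !linear0 add0r addr0. Qed.
Definition from_idrep : {linear idrep P -> Z} := t2_linear from_idrep1 from_idrep21.
Lemma from_idrepE z : from_idrep z = idem1 Z (b z.1) + arrow Z (b z.2) :> res Z.
Proof. by []. Qed.
End FromIdrep.

Section ToBotrep.
Variable q : {linear res Z -> P}.
Hypotheses (q1 : forall z, q (idem1 Z z) = 0) (q21 : forall z, q (arrow Z z) = 0).
Fact to_botrep1 z : (t2in2 _ \o q) (idem1 Z z) = idem1 (botrep P) ((t2in2 _ \o q) z).
Proof. by rewrite t2rep_idem1 /= q1. Qed.
Fact to_botrep21 z : (t2in2 _ \o q) (arrow Z z) = arrow (botrep P) ((t2in2 _ \o q) z).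
Proof. by rewrite t2rep_arrow /= q21. Qed.
Definition to_botrep : {linear Z -> botrep P} := t2_linear to_botrep1 to_botrep21.
Lemma to_botrepE z : to_botrep z = (0, q z).
Proof. by []. Qed.
End ToBotrep.

Section FromBotrep.
Variable b : {linear P -> res Z}.
Fact from_botrep1 z :
  (idem2 Z \o (b \o t2snd _)) (idem1 (botrep P) z) = idem1 Z ((idem2 Z \o (b \o t2snd _)) z).
Proof. by rewrite t2rep_idem1 /= !t2actE !linear0. Qed.
Fact from_botrep21 z :
  (idem2 Z \o (b \o t2snd _)) (arrow (botrep P) z) = arrow Z ((idem2 Z \o (b \o t2snd _)) z).
Proof. by rewrite t2rep_arrow /= !t2actE !linear0. Qed.
Definition from_botrep : {linear botrep P -> Z} := t2_linear from_botrep1 from_botrep21.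
Lemma from_botrepE z : from_botrep z = idem2 Z (b z.2) :> res Z.
Proof. by []. Qed.
End FromBotrep.

End RepresentationMaps.

(** The functor [idrep] is left adjoint to the exact functor sending X -> Y to X. *)
Lemma projective_idrep P : projective_module P -> projective_module (idrep P).
Proof.
move=> projP M N p f p_surj.
have [g gE] := projP _ _ (resl p) (resl f \o t2in1 _) p_surj.
exists (from_idrep g) => z; rewrite from_idrepE.
have -> : p (idem1 M (g z.1) + arrow M (g z.2)) =
          idem1 N (resl p (g z.1)) + arrow N (resl p (g z.2)) :> res N.
  by rewrite [LHS](linearD p); congr (_ + _); [apply: resl_idem1 | apply: resl_arrow].
rewrite !gE /= -(resl_idem1 f) -(resl_arrow f) -[LHS](linearD f); congr (f _).
by rewrite t2rep_idem1 t2rep_arrow; case: z => x y; congr pair; rewrite /= ?addr0 ?add0r.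
Qed.

Lemma projective_botrep P : projective_module P -> projective_module (botrep P).
Proof.
move=> projP M N p f p_surj.
have [g gE] := projP _ _ (resl p) (resl f \o t2in2 _) p_surj.
exists (from_botrep g) => z; rewrite from_botrepE.
rewrite [LHS](resl_idem2 p); have /= -> := gE z.2.
rewrite -(resl_idem2 f); congr (f _).
by rewrite t2rep_idem2; case: z => x y; congr pair; apply/rowP => -[].
Qed.

(** The functor [idrep] is also right adjoint to the exact functor sending X -> Y to Y. *)
Lemma injective_idrep P : injective_module P -> injective_module (idrep P).
Proof.
move=> injP M N i f i_inj.
have [g gE] := injP _ _ (resl i) (t2snd _ \o resl f) i_inj.
exists (to_idrep g) => m; rewrite to_idrepE.
rewrite -(resl_arrow i) -(resl_idem2 i).
have /= -> := gE (arrow M m); have /= -> := gE (idem2 M m).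
by rewrite (resl_arrow f) (resl_idem2 f) t2rep_arrow t2rep_idem2; case: (f m).
Qed.

(** A projective [R] is a direct summand of a sum of modules M = M and 0 -> M, whose structure maps
    are injective. *)
Lemma projective_arrow_ker (R : lmodType (T2 A)) : projective_module R ->
  forall r : res R, idem2 R r = 0 -> arrow R r = 0 -> r = 0.
Proof.
move=> projR r r2 r21.
pose p : {linear (idrep (res R) * botrep (res R))%type -> R} :=
  (from_idrep idfun \o fst) \+ (from_botrep idfun \o snd).
have [|s sK] := projective_section (p := p) projR.
  move=> y; exists ((y, 0), (0, y)).
  rewrite -[RHS](idem_sum y) /p /= ; congr (_ + _).
  by rewrite linear0 addr0.
have s0 : s r = 0.
  pose s1 : {linear R -> idrep (res R)} := fst \o s.
  pose s2 : {linear R -> botrep (res R)} := snd \o s.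
  have := resl_arrow s1 r; have := resl_idem2 s1 r; have := resl_idem2 s2 r.
  rewrite r2 r21 !linear0 !t2rep_idem2 t2rep_arrow => -[e4] [e2] [e1].
  rewrite [s r]surjective_pairing [(s r).1]surjective_pairing [(s r).2]surjective_pairing.
  by rewrite -e1 -e2 -e4; congr (_, (_, _)); apply/rowP => -[].
by rewrite -[r]sK s0 linear0.
Qed.

End T2Projectives.

(** * Injective and projective objects of the stable category of T_2(A) *)

Section StableT2.
Variables (k : fieldType) (A : falgType k).

Section QuotientRepresentation.
Variables (M P : lmodType A) (j : {linear M -> P}).

Definition quotrep : lmodType (T2 A) := t2rep (cokerm_pi j : {linear P -> cokerm j}).

Definition idrep_quotrep : {linear idrep P -> quotrep} :=
  from_idrep (t2in1 (cokerm_pi j : {linear P -> cokerm j})).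

Lemma idrep_quotrepE z : idrep_quotrep z = (z.1, cokerm_pi j z.2).
Proof.
rewrite from_idrepE t2rep_idem1 t2rep_arrow.
by congr pair; rewrite /= ?addr0 ?add0r.
Qed.

Lemma idrep_quotrep_surj z : exists y, idrep_quotrep y = z.
Proof.
case: z => x y; have [y' <-] := cokerm_pi_surj y.
by exists (x, y'); rewrite idrep_quotrepE.
Qed.

Hypotheses (fdP : finite_dim P) (projP : projective_module P) (injP : injective_module P).

Lemma finite_dim_quotrep : finite_dim quotrep.
Proof.
by apply: finite_dim_t2rep => //; apply: finite_dim_surj fdP; apply: cokerm_pi_surj.
Qed.

Lemma stably_injective_quotrep : stably_injective quotrep.
Proof.
apply: stably_injective_quotient idrep_quotrep_surj.
- exact: finite_dim_idrep.
- exact: projective_idrep.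
- exact: injective_idrep.
Qed.

(** The kernel of (P = P) -> (P -> P/M) lives at the target vertex, where the map to Q = Q built
    from an embedding into [Q] is injective. *)
Lemma stably_projective_quotrep : self_injective A -> stably_projective quotrep.
Proof.
move=> injA; apply: stably_projective_quotient idrep_quotrep_surj _.
  exact: projective_idrep.
move=> N fdN; have /finite_dim_res fdN' := fdN.
have [Q [fdQ projQ _ [i i_inj]]] := projective_embedding injA fdN'.
exists (idrep Q), (to_idrep i); split.
- exact: finite_dim_idrep.
- exact: projective_idrep.
move=> m y; rewrite idrep_quotrepE to_idrepE => -[y1 _] [_ im].
have y2 : idem2 _ y = y by rewrite t2rep_idem2 -y1 -surjective_pairing.
by rewrite -y2 (resl_idem2 m); apply: i_inj; rewrite im linear0.
Qed.

End QuotientRepresentation.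

Section VertexCokernel.
Variable Z : lmodType (T2 A).
(** The image is X plus the image of the structure map, so the cokernel is that of X -> Y. *)
Definition vertex_span : {linear (res Z * res Z)%type -> res Z} :=
  (idem1 Z \o fst) \+ (arrow Z \o snd).
Definition vertex_coker : lmodType A := cokerm vertex_span.
Definition vertex_pi : {linear res Z -> vertex_coker} := cokerm_pi vertex_span.

Lemma vertex_pi_eq0 z : vertex_pi z = 0 <-> exists a b, z = idem1 Z a + arrow Z b.
Proof.
rewrite cokerm_pi_eq0; split=> [[[a b] <-]|[a [b ->]]]; first by exists a, b.
by exists (a, b).
Qed.

Lemma vertex_pi1 z : vertex_pi (idem1 Z z) = 0.
Proof. by apply/vertex_pi_eq0; exists z, 0; rewrite linear0 addr0. Qed.

Lemma vertex_pi21 z : vertex_pi (arrow Z z) = 0.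
Proof. by apply/vertex_pi_eq0; exists 0, z; rewrite linear0 add0r. Qed.

Lemma vertex_pi2 z : vertex_pi (idem2 Z z) = vertex_pi z.
Proof. by rewrite -[z in RHS]idem_sum linearD /= vertex_pi1 add0r. Qed.

Lemma vertex_pi_surj y : exists z, vertex_pi z = y.
Proof. exact: cokerm_pi_surj. Qed.

End VertexCokernel.

Lemma vertex_factor (Z : lmodType (T2 A)) (M : lmodType A) (q : {linear res Z -> M}) :
    (forall z, q (idem1 Z z) = 0) -> (forall z, q (arrow Z z) = 0) ->
  exists g : {linear vertex_coker Z -> M}, forall z, g (vertex_pi Z z) = q z.
Proof.
move=> q1 q21; apply: factor_surj; first exact: vertex_pi_surj.
by move=> z /vertex_pi_eq0[a [b ->]]; rewrite linearD q1 q21 addr0.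
Qed.

Lemma finite_dim_vertex_coker Z : finite_dim Z -> finite_dim (vertex_coker Z).
Proof. by move=> /finite_dim_res; apply: finite_dim_surj (@vertex_pi_surj Z). Qed.

(* The map Z -> (X + Q -> Y), where Z = (X -> Y) and Q -> Y is onto, is a stable
   monomorphism because its cokernel (Q -> 0) has syzygy the projective (0 -> Q). *)
Lemma stable_mono_surjective_arrow (Z : lmodType (T2 A)) : finite_dim Z ->
  exists (W : lmodType (T2 A)) (i : {linear Z -> W}), [/\ finite_dim W, stable_mono i
    & forall w, exists w', idem2 W w = arrow W w'].
Proof.
move=> fdZ; have /finite_dim_res fdZ' := fdZ.
have [Q [fdQ projQ _ [q q_surj]]] := projective_cover fdZ'.
pose c : {linear botrep Q -> idrep Q} := from_botrep (t2in2 (idfun : {linear Q -> Q})).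
have cE y : c y = (0, y.2) by rewrite /c from_botrepE t2rep_idem2.
have c_inj : injective c.
  apply: raddf_inj => y cy; have [y2] := etrans (esym (cE y)) cy.
  by rewrite [y]surjective_pairing y2; congr pair; apply/rowP => -[].
have hP : linear (fun y => (from_botrep q y, c y)) by move=> a x y; rewrite !linearP.
pose h : {linear botrep Q -> (Z * idrep Q)%type} := linear_of hP.
have h_inj : injective h by move=> x y [_ /c_inj].
pose p : {linear (Z * idrep Q)%type -> cokerm h} := cokerm_pi h.
have p_surj : forall y, exists x, p x = y := @cokerm_pi_surj _ _ _ _.
have p0 x : p x = 0 <-> exists y, h y = x := cokerm_pi_eq0 _ _.
exists (cokerm h), (p \o @modinl _ _ Z (idrep Q) : {linear Z -> cokerm h}); split.
- by apply: finite_dim_surj p_surj (finite_dim_pair fdZ (finite_dim_idrep fdQ)).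
- move=> T a fdT [R [u [v [fdR projR uv]]]].
  have [v' v'E] := projR _ _ p v p_surj.
  pose d : {linear T -> (Z * idrep Q)%type} := (@modinl _ _ Z (idrep Q) \o a) \- (v' \o u).
  have [|e eE] := @factor_inj _ _ _ _ h d h_inj.
    move=> t; apply/p0; rewrite /d /= linearB v'E -uv; exact: subrr.
  apply: (@stably_zero_ext _ _ _ _ (fun t => fst (v' (u t)) + from_botrep q (e t))).
    move=> t; have /= := congr1 fst (eE t); rewrite /d /= => ->.
    by rewrite addrC subrK.
  apply: stably_zeroD.
    by exists R, u, (fst \o v' : {linear R -> Z}).
  exists (botrep Q), e, (from_botrep q); split=> //.
    exact: finite_dim_botrep.
  exact: projective_botrep.
- move=> w; have [[z x] <-] := p_surj w.
  have [y yE] := q_surj z.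
  (* With [q y = z], subtracting the arrow of this element from the [idem2] part of (z, x) leaves
     (idem2 z, (0, y)), which is [h (0, y)]. *)
  exists (p (0, (x.2 + - y, 0))).
  rewrite -(resl_idem2 p) -(resl_arrow p); apply/subr0_eq; rewrite -[LHS](linearB p).
  apply/p0; exists (0, y); rewrite idem2E arrowE.
  have -> : h (0, y) = (from_botrep q (0, y), c (0, y)) by [].
  rewrite from_botrepE cE /= yE idem2E; congr pair => /=.
    by rewrite scaler0 subr0.
  rewrite !t2repE; congr pair; rewrite /= !scale0r ?scale1r ?subr0 //.
  by rewrite add0r addr0 subKr.
Qed.

(** The identity of [Z] extends stably to [r] on a module [W] with surjective arrow. Such an [r]
    dies in the cokernel, so modulo X and the image of the arrow the identity factors through the
    projective [R]. *)
Lemma projective_vertex_coker (Z : lmodType (T2 A)) :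
  finite_dim Z -> stably_injective Z -> projective_module (vertex_coker Z).
Proof.
move=> fdZ injZ; have [W [i [fdW i_mono W2]]] := stable_mono_surjective_arrow fdZ.
have [r [R [u [v [fdR projR uv]]]]] := injZ _ _ i idfun fdZ fdW i_mono.
have r0 w : vertex_pi Z (r w) = 0.
  have [w' w'E] := W2 w.
  by rewrite -vertex_pi2 -(resl_idem2 r) w'E (resl_arrow r) vertex_pi21.
have piE z : vertex_pi Z z = - vertex_pi Z (v (u z)).
  by rewrite -uv linearB r0 /= sub0r opprK.
move=> M N p f p_surj.
pose q : {linear res R -> N} := f \o (vertex_pi Z \o resl v).
have q1 x : q (idem1 R x) = 0 by rewrite /q /= (resl_idem1 v) vertex_pi1 linear0.
have q21 x : q (arrow R x) = 0 by rewrite /q /= (resl_arrow v) vertex_pi21 linear0.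
(* The lifting problem is moved to (0 -> M) -> (0 -> N), where projectivity of [R] applies. *)
pose bp : {linear botrep M -> botrep N} := from_botrep (t2in2 (\0 : {linear 'rV[A]_0 -> N}) \o p).
have bpE y : bp y = (0, p y.2) by rewrite /bp from_botrepE t2rep_idem2.
have [|g gE] := projR _ _ bp (to_botrep q1 q21).
  move=> [x y]; have [y' <-] := p_surj y; exists (0, y'); rewrite bpE.
  by congr pair; apply/rowP => -[].
have [||g' g'E] := @vertex_factor Z M (t2snd _ \o resl (g \o u)).
- by move=> z /=; have /= -> := resl_idem1 (g \o u) z; rewrite t2rep_idem1.
- by move=> z /=; have /= -> := resl_arrow (g \o u) z; rewrite t2rep_arrow.
exists (\- g' : {linear vertex_coker Z -> M}) => y; have [z <-] := vertex_pi_surj y.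
rewrite /= linearN g'E piE linearN; congr (- _) => /=.
by have := congr1 snd (gE (u z)); rewrite bpE to_botrepE.
Qed.

End StableT2.

(** * Projective sources and the kernel of the structure map *)

Section ArrowKernel.
Variables (k : fieldType) (A : falgType k).

(* [idem1 Z] is the projection onto the source X of Z = (X -> Y): this says that X is
   projective, without forming X as a module. *)
Definition projective_source (Z : lmodType (T2 A)) :=
  exists (P : lmodType A) (a : {linear res Z -> P}) (b : {linear P -> res Z}),
    [/\ finite_dim P, projective_module P & forall z, b (a z) = idem1 Z z].

Lemma projective_projective_source (R : lmodType (T2 A)) :
  finite_dim R -> projective_module R -> projective_source R.
Proof.
move=> /finite_dim_res fdR projR.
have [Q [fdQ projQ _ [q q_surj]]] := projective_cover fdR.
pose p : {linear (idrep Q * botrep Q)%type -> R} :=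
  (from_idrep q \o fst) \+ (from_botrep q \o snd).
have pE x : p x = idem1 R (q x.1.1) + arrow R (q x.1.2) + idem2 R (q x.2.2) :> res R by [].
have [|s sK] := projective_section (p := p) projR.
  move=> y; have [x xE] := q_surj y; exists ((x, 0), (0, x)).
  by rewrite pE /= xE !linear0 addr0 idem_sum.
exists Q, (t2fst _ \o resl (fst \o s : {linear R -> idrep Q})), (idem1 R \o q); split=> // z /=.
rewrite -[in RHS](sK z) pE !linearD idem11 idem1_arrow idem12.
by rewrite !addr0.
Qed.

(* The map (Q -> Y) -> Z, where Z = (X -> Y) and Q -> X is onto, is a stable epimorphism
   because its kernel (K -> 0) has no nonzero map to a projective. *)
Lemma stable_epi_projective_source (Z : lmodType (T2 A)) : finite_dim Z ->
  exists (Q : lmodType A) (q : {linear Q -> res Z}) (W : lmodType (T2 A)) (p : {linear W -> Z})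
      (a : {linear res W -> Q}),
    [/\ finite_dim Q, projective_module Q, finite_dim W, stable_epi p
      & forall w, idem1 Z (p w) = idem1 Z (q (a w))].
Proof.
move=> fdZ; have /finite_dim_res fdZ' := fdZ.
have [Q [fdQ projQ _ [q q_surj]]] := projective_cover fdZ'.
pose i := kerm_inj (idem1 Z).
have i_inj : injective i := @kerm_injI _ _ _ _.
have i1 y : idem1 Z (i y) = 0 := kermE y.
have i2 y : idem2 Z (i y) = i y by rewrite -[RHS]idem_sum i1 add0r.
have i21 y : arrow Z (i y) = 0 by rewrite -i2 arrow2.
have [|phi phiE] := @factor_inj _ _ _ _ i (arrow Z \o q) i_inj.
  by move=> x; apply: kerm_ex; rewrite /= idem1_arrow.
pose W : lmodType (T2 A) := t2rep phi.
pose p0 : {linear res W -> res Z} := (idem1 Z \o (q \o t2fst phi)) \+ (i \o t2snd phi).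
have p0E w : p0 w = idem1 Z (q w.1) + i w.2 by [].
have p0P x y : p0 (x, y) = idem1 Z (q x) + i y by [].
have p1 w : p0 (idem1 W w) = idem1 Z (p0 w).
  by rewrite t2rep_idem1 p0P p0E linearD idem11 i1 (linear0 i).
have p21 w : p0 (arrow W w) = arrow Z (p0 w).
  by rewrite t2rep_arrow p0P p0E phiE linearD arrow1 i21 !linear0 add0r addr0.
pose p : {linear W -> Z} := t2_linear p1 p21.
have pE w : p w = idem1 Z (q w.1) + i w.2 by [].
have p_surj z : exists w, p w = z.
  have [x xE] := q_surj z; have [|y yE] := @kerm_ex _ _ _ (idem1 Z) (idem2 Z z).
    exact: idem12.
  by exists (x, y); rewrite pE xE yE; apply: idem_sum.
exists Q, q, W, p, (t2fst phi); split=> //.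
- by apply: finite_dim_t2rep => //; apply: finite_dim_inj i_inj fdZ'.
- move=> T a fdT [R [u [v [fdR projR uv]]]].
  (* The kernel of [p] lies in the kernel of the arrow of [W], where [u] vanishes by
     [projective_arrow_ker]. *)
  have [w|u' u'E] := factor_surj (u := p) (v := u) p_surj.
    rewrite pE => pw; have w2 : w.2 = 0.
      apply: i_inj; rewrite [RHS](linear0 i) -i2; have := congr1 (idem2 Z) pw.
      by rewrite linearD idem21 add0r linear0.
    move: pw; rewrite w2 linear0 addr0 => pw.
    apply: (projective_arrow_ker projR).
      by rewrite -(resl_idem2 u) t2rep_idem2 w2; apply: (linear0 u).
    rewrite -(resl_arrow u) t2rep_arrow (_ : phi w.1 = 0); first exact: (linear0 u).
    by apply: i_inj; rewrite phiE linear0 /= -arrow1 pw linear0.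
  exists R, u', v; split=> // z; have [w <-] := p_surj z.
  by rewrite u'E -uv.
- by move=> w; rewrite pE linearD idem11 i1 addr0.
Qed.

(** The identity of [Z] lifts stably through the stable epimorphism [p], so [idem1] is the
    difference of a map through [Q] and one through the source of a projective. *)
Lemma stably_projective_source (Z : lmodType (T2 A)) :
  finite_dim Z -> stably_projective Z -> projective_source Z.
Proof.
move=> fdZ projZ.
have [Q [q [W [p [a [fdQ projQ fdW p_epi pE]]]]]] := stable_epi_projective_source fdZ.
have [s [R [u [v [fdR projR uv]]]]] := projZ _ _ p idfun fdW fdZ p_epi.
have [P [c [b [fdP projP bc]]]] := projective_projective_source fdR projR.
have eP : linear (fun z : res Z => (a (s z), c (u z))).
  by move=> d x y; rewrite (linearP (resl s)) (linearP (resl u)) !linearP.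
exists (Q * P)%type, (linear_of eP),
  ((idem1 Z \o (q \o fst)) \- (resl v \o (b \o snd))); split.
- exact: finite_dim_pair.
- exact: projective_pair.
move=> z /=; rewrite -pE bc (resl_idem1 v) -uv linearB /=.
by rewrite subKr.
Qed.

Fact arrow_ker_linear (Z : lmodType (T2 A)) :
  linear (fun z : res Z => (idem2 Z z, arrow Z z)).
Proof. by move=> a y z; rewrite !linearP. Qed.

(** Elements killed by [idem2] are those of X, so this is the kernel of X -> Y, obtained without
    forming X. *)
Definition arrow_ker (Z : lmodType (T2 A)) : lmodType A := kerm (linear_of (@arrow_ker_linear Z)).
Definition arrow_ker_inj (Z : lmodType (T2 A)) : {linear arrow_ker Z -> res Z} := kerm_inj _.
Arguments arrow_ker_inj {Z}.

Lemma arrow_ker_injI Z : injective (@arrow_ker_inj Z).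
Proof. exact: kerm_injI. Qed.

Lemma arrow_ker_idem2 Z (x : arrow_ker Z) : idem2 Z (arrow_ker_inj x) = 0.
Proof. by have [] := kermE x. Qed.

Lemma arrow_ker_arrow Z (x : arrow_ker Z) : arrow Z (arrow_ker_inj x) = 0.
Proof. by have [] := kermE x. Qed.

Lemma arrow_ker_idem1 Z (x : arrow_ker Z) : idem1 Z (arrow_ker_inj x) = arrow_ker_inj x.
Proof. by rewrite -[RHS]idem_sum arrow_ker_idem2 addr0. Qed.

Lemma arrow_ker_ex Z (z : res Z) : idem2 Z z = 0 -> arrow Z z = 0 ->
  exists x, arrow_ker_inj x = z :> res Z.
Proof. by move=> z2 z21; apply: kerm_ex; rewrite /= z2 z21. Qed.

Lemma finite_dim_arrow_ker Z : finite_dim Z -> finite_dim (arrow_ker Z).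
Proof. by move=> /finite_dim_res; apply: finite_dim_inj (@arrow_ker_injI Z). Qed.

Section KernelFunctor.
Variables Y Z : lmodType (T2 A).

Lemma arrow_ker_map_ex (f : {linear Y -> Z}) : exists g : {linear arrow_ker Y -> arrow_ker Z},
  forall x, arrow_ker_inj (g x) = f (arrow_ker_inj x).
Proof.
have [|g gE] := @factor_inj _ _ _ _ (arrow_ker_inj (Z := Z)) (resl f \o arrow_ker_inj (Z := Y))
  (@arrow_ker_injI Z); last by exists g.
move=> x; apply: arrow_ker_ex => /=.
  by rewrite -(resl_idem2 f) arrow_ker_idem2; apply: (linear0 f).
by rewrite -(resl_arrow f) arrow_ker_arrow; apply: (linear0 f).
Qed.

Hypotheses (injA : self_injective A) (fdY : finite_dim Y).
Hypotheses (cokerY : projective_module (vertex_coker Y)) (sourceZ : projective_source Z).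

(** The source part of [f] vanishes on the kernel of the arrow, so by injectivity of [P] it extends
    along the arrow. This gives a map through P = P that agrees with [f] on the source; the
    difference factors through 0 -> C with C the projective cokernel. *)
Lemma arrow_ker_faithful (f : {linear Y -> Z}) :
  (forall x, f (arrow_ker_inj (Z := Y) x) = 0) -> stably_zero f.
Proof.
move=> f0; have [P [a [b [fdP projP ba]]]] := sourceZ.
have injP := projective_injective injA fdP projP.
have [y y21|c cE] := injective_factor (u := arrow Y) (v := a \o (resl f \o idem1 Y)) injP.
  have [||x xE] := @arrow_ker_ex Y (idem1 Y y); rewrite ?idem21 ?arrow1 //.
  by rewrite /= -xE f0 linear0.
pose f' : {linear Y -> Z} := f \- (from_idrep b \o to_idrep c).
have f'E y : f' y = f y - (idem1 Z (b (c (arrow Y y))) + arrow Z (b (c (idem2 Y y)))) :> res Z.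
  by [].
have f'1 y : f' (idem1 Y y) = 0.
  rewrite f'E arrow1 idem21 !linear0 addr0 cE /= ba idem11 (resl_idem1 f) idem11.
  exact: subrr.
have f'21 y : f' (arrow Y y) = 0.
  by rewrite -arrow1 (resl_arrow f') f'1 linear0.
have [||g gE] := @vertex_factor _ _ Y _ (resl f'); [exact: f'1 | exact: f'21 |].
apply: (@stably_zero_ext _ _ _ _ (fun y =>
   from_botrep g (to_botrep (@vertex_pi1 _ _ Y) (@vertex_pi21 _ _ Y) y) +
   from_idrep b (to_idrep c y))).
  move=> y; rewrite from_botrepE to_botrepE /= gE.
  rewrite -(resl_idem2 f') -[LHS](_ : f' (idem2 Y y) + (f y - f' y) = _); last first.
    by congr (_ + _); rewrite /f' /= subKr.
  rewrite -[in f' y](idem_sum y) (linearD f') f'1 add0r addrCA subrr; exact: addr0.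
apply: stably_zeroD.
  exists (botrep (vertex_coker Y)), (to_botrep (@vertex_pi1 _ _ Y) (@vertex_pi21 _ _ Y)),
    (from_botrep g); split=> //; last exact: projective_botrep.
  exact/finite_dim_botrep/finite_dim_vertex_coker.
exists (idrep P), (to_idrep c), (from_idrep b); split=> //.
  exact: finite_dim_idrep.
exact: projective_idrep.
Qed.

(** Injectivity of [P] extends [h] to a source map [f1]. It respects the kernels of the arrows,
    hence induces a map on the image of the arrow, extended by zero to the complement that the
    projective cokernel provides. *)
Lemma arrow_ker_full (h : {linear arrow_ker Y -> arrow_ker Z}) :
  exists f : {linear Y -> Z}, forall x, arrow_ker_inj (h x) = f (arrow_ker_inj x).
Proof.
have [P [a [b [fdP projP ba]]]] := sourceZ.
have injP := projective_injective injA fdP projP.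
have [e eE] := injP _ _ (arrow_ker_inj (Z := Y)) (a \o (arrow_ker_inj (Z := Z) \o h))
  (@arrow_ker_injI Y).
pose f1 : {linear res Y -> res Z} := idem1 Z \o (b \o (e \o idem1 Y)).
have f1E y : f1 y = idem1 Z (b (e (idem1 Y y))) by [].
have f1h x : f1 (arrow_ker_inj x) = arrow_ker_inj (h x).
  by rewrite f1E arrow_ker_idem1 eE /= ba idem11 arrow_ker_idem1.
have f1_ker y : arrow Y y = 0 -> arrow Z (f1 y) = 0.
  move=> y21; have [x xE] : exists x, arrow_ker_inj x = idem1 Y y.
    by apply: arrow_ker_ex; rewrite ?idem21 ?arrow1.
  have -> : f1 y = f1 (idem1 Y y) by rewrite !f1E idem11.
  by rewrite -xE f1h arrow_ker_arrow.
have [s sK] := projective_section cokerY (@vertex_pi_surj _ _ Y).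
(* The section [s] makes [u] onto, and [v] prescribes the target map: zero on the source and on the
   section, [arrow Z (f1 y)] on [arrow Y y]. *)
pose u : {linear (res Y * (res Y * vertex_coker Y))%type -> res Y} :=
  (idem1 Y \o fst) \+ ((arrow Y \o (fst \o snd)) \+ (s \o (snd \o snd))).
have uE x : u x = idem1 Y x.1 + (arrow Y x.2.1 + s x.2.2) by [].
pose v : {linear (res Y * (res Y * vertex_coker Y))%type -> res Z} :=
  arrow Z \o (f1 \o (fst \o snd)).
have vE x : v x = arrow Z (f1 x.2.1) by [].
have [||d dE] := factor_surj (u := u) (v := v).
- move=> y; have /vertex_pi_eq0[y1 [y2 yE]] : vertex_pi Y (y - s (vertex_pi Y y)) = 0.
    by rewrite linearB sK subrr.
  exists (y1, (y2, vertex_pi Y y)); rewrite uE /= addrA -yE.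
  exact: subrK.
- move=> [y1 [y2 y3]]; rewrite uE vE /= => uy.
  have y30 : y3 = 0.
    have := congr1 (vertex_pi Y) uy; rewrite !linearD linear0 /= vertex_pi1 vertex_pi21 sK.
    by rewrite !add0r.
  move: uy; rewrite y30 linear0 addr0 => uy; apply: f1_ker.
  by have := congr1 (idem2 Y) uy; rewrite linearD linear0 idem21 idem2_arrow add0r.
have d1 y : d (idem1 Y y) = 0.
  by have := dE (y, (0, 0)); rewrite uE vE /= !linear0 !addr0.
have d21 y : d (arrow Y y) = arrow Z (f1 y).
  by have := dE (0, (y, 0)); rewrite uE vE /= !linear0 add0r addr0.
have d2 y : d (idem2 Y y) = d y by rewrite -[in RHS](idem_sum y) linearD /= d1 add0r.
pose f0 : {linear res Y -> res Z} := f1 \+ (idem2 Z \o d).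
have f0E y : f0 y = f1 y + idem2 Z (d y) by [].
have f01 y : f0 (idem1 Y y) = idem1 Z (f0 y).
  by rewrite !f0E d1 linear0 addr0 linearD idem12 addr0 !f1E !idem11.
have f021 y : f0 (arrow Y y) = arrow Z (f0 y).
  rewrite !f0E d21 linearD idem2_arrow arrow2 addr0 [f1 (arrow Y y)]f1E.
  by rewrite idem1_arrow !linear0 add0r.
exists (t2_linear f01 f021) => x.
rewrite -[RHS]/(f0 (arrow_ker_inj x)) f0E f1h -d2 arrow_ker_idem2 !linear0.
by rewrite addr0.
Qed.

End KernelFunctor.

Lemma arrow_ker_quotrep (M P : lmodType A) (j : {linear M -> P}) : injective j ->
  exists (u : {linear arrow_ker (quotrep j) -> M}) (v : {linear M -> arrow_ker (quotrep j)}),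
    cancel u v /\ cancel v u.
Proof.
move=> j_inj; have [|v vE] := @factor_inj _ _ _ _ (arrow_ker_inj (Z := quotrep j))
  (t2in1 _ \o j) (@arrow_ker_injI _).
  move=> m; apply: arrow_ker_ex; first by rewrite t2rep_idem2.
  rewrite t2rep_arrow /=; congr pair; apply/cokerm_pi_eq0.
  by exists m.
have [|u uE] := @factor_inj _ _ _ _ j (t2fst _ \o arrow_ker_inj (Z := quotrep j)) j_inj.
  move=> x; have := arrow_ker_arrow x; rewrite t2rep_arrow => -[].
  by move=> /cokerm_pi_eq0.
exists u, v; split=> [x|m].
  apply: arrow_ker_injI; rewrite vE /= uE /=.
  by have := arrow_ker_idem1 x; rewrite t2rep_idem1.
by apply: j_inj; rewrite uE; apply: (congr1 fst (vE m)).
Qed.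

End ArrowKernel.

Arguments arrow_ker_inj {k A Z}.

(** * Equivalences of linear categories *)

Local Notation kcomp := Defs.comp.

Section LinearCategories.
Variable k : fieldType.
Implicit Types C D E : kcat k.

Definition fully_faithful C D (F : kfunctor C D) :=
  forall x y, (forall f : mor C x y, fmor F f = 0 -> f = 0) /\
    (forall g : mor D (F x) (F y), exists f, fmor F f = g).

Definition isomorphic C (x y : C) := exists (u : mor C x y) (v : mor C y x),
  kcomp v u = idm C x /\ kcomp u v = idm C y.

Definition essentially_surjective C D (F : kfunctor C D) := forall y, exists x, isomorphic (F x) y.

Lemma comp_zerol C (x y z : C) (f : mor C x y) : kcomp (0 : mor C y z) f = 0.
Proof.
have := comp_linearl f 1 (0 : mor C y z) 0; rewrite !scale1r addr0.
by move/(congr1 (fun g => g - kcomp 0 f)); rewrite subrr addrK => /esym.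
Qed.

Lemma comp_zeror C (x y z : C) (g : mor C y z) : kcomp g (0 : mor C x y) = 0.
Proof.
have := comp_linearr g 1 (0 : mor C x y) 0; rewrite !scale1r addr0.
by move/(congr1 (fun f => f - kcomp g 0)); rewrite subrr addrK => /esym.
Qed.

Lemma fully_faithful_inj C D (F : kfunctor C D) : fully_faithful F ->
  forall x y (f g : mor C x y), fmor F f = fmor F g -> f = g.
Proof.
move=> ffF x y f g fg; apply/subr0_eq; have [H _] := ffF x y.
by apply: H; rewrite linearB fg subrr.
Qed.

Lemma isomorphic_trans C (x y z : C) : isomorphic x y -> isomorphic y z -> isomorphic x z.
Proof.
case=> u [v [vu uv]] [u' [v' [vu' uv']]]; exists (kcomp u' u), (kcomp v v'); split.
  by rewrite -Defs.compA [kcomp v' _]Defs.compA vu' comp1m.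
by rewrite -Defs.compA [kcomp u _]Defs.compA uv comp1m.
Qed.

Lemma isomorphic_fmor C D (F : kfunctor C D) x y : isomorphic x y -> isomorphic (F x) (F y).
Proof.
case=> u [v [vu uv]]; exists (fmor F u), (fmor F v).
by rewrite -!fmorM vu uv !fmor1.
Qed.

Lemma fully_faithful_comp C D E (G : kfunctor D E) (F : kfunctor C D) :
  fully_faithful G -> fully_faithful F -> fully_faithful (compfunctor G F).
Proof.
move=> ffG ffF x y; have [F0 Fs] := ffF x y; have [G0 Gs] := ffG (F x) (F y).
split=> [f /G0/F0 //|h]; have [g <-] := Gs h; have [f <-] := Fs g.
by exists f.
Qed.

Lemma essentially_surjective_comp C D E (G : kfunctor D E) (F : kfunctor C D) :
  essentially_surjective G -> essentially_surjective F ->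
  essentially_surjective (compfunctor G F).
Proof.
move=> esG esF z; have [y yz] := esG z; have [x xy] := esF y.
by exists x; exact: isomorphic_trans (isomorphic_fmor G xy) yz.
Qed.

Lemma nat_iso_isomorphic C (F : kfunctor C C) x :
  nat_iso F (idfunctor C) -> isomorphic (F x) x.
Proof. by case=> u [v [vu uv _]]; exists (u x), (v x); split; [exact: vu | exact: uv]. Qed.

Lemma equiv_fully_faithful C D (F : kfunctor C D) (G : kfunctor D C) :
    nat_iso (compfunctor G F) (idfunctor C) -> nat_iso (compfunctor F G) (idfunctor D) ->
  fully_faithful F.
Proof.
have faithful C' D' (F' : kfunctor C' D') (G' : kfunctor D' C') x y (f g : mor C' x y) :
    nat_iso (compfunctor G' F') (idfunctor C') -> fmor F' f = fmor F' g -> f = g.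
  case=> u [v [vu uv nat]] fg.
  have fE h : h = kcomp (u y) (kcomp (fmor G' (fmor F' h)) (v x)).
    by rewrite Defs.compA nat /= -Defs.compA uv compm1.
  by rewrite [f]fE fg -fE.
move=> GF FG x y; split=> [f Ff|g].
  by apply: faithful GF _; rewrite Ff linear0.
have [u [v [vu uv nat]]] := GF.
pose f := kcomp (u y) (kcomp (fmor G g) (v x)); exists f.
(* As [G] is faithful, [fmor F f = g] may be checked after applying [G], and there after composing
   with the isomorphism [u y]. *)
apply: (faithful _ _ G F _ _ _ _ FG).
have fE : kcomp (u y) (fmor G (fmor F f)) = kcomp (u y) (fmor G g).
  by rewrite nat /f /= -!Defs.compA vu compm1.
have := congr1 (kcomp (v y)) fE; rewrite !Defs.compA vu.
by rewrite !comp1m.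
Qed.

Lemma fully_faithful_inverse C D (F : kfunctor C D) :
    fully_faithful F -> essentially_surjective F ->
  exists G : kfunctor D C, nat_iso (compfunctor G F) (idfunctor C) /\
    nat_iso (compfunctor F G) (idfunctor D).
Proof.
move=> ffF esF.
have inj := fully_faithful_inj ffF.
pose pre x y (g : mor D (F x) (F y)) : mor C x y := projT1 (cid ((ffF x y).2 g)).
have preE x y (g : mor D (F x) (F y)) : fmor F (pre x y g) = g := projT2 (cid ((ffF x y).2 g)).
pose G y : C := projT1 (cid (esF y)).
have isoG y : isomorphic (F (G y)) y := projT2 (cid (esF y)).
pose u y : mor D (F (G y)) y := projT1 (cid (isoG y)).
have uE y := projT2 (cid (isoG y)).
pose v y : mor D y (F (G y)) := projT1 (cid (uE y)).
have [vu uv] : (forall y, kcomp (v y) (u y) = idm D (F (G y))) /\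
               (forall y, kcomp (u y) (v y) = idm D y).
  by split=> y; have [] := projT2 (cid (uE y)).
pose Gm y z (g : mor D y z) : mor C (G y) (G z) := pre _ _ (kcomp (v z) (kcomp g (u y))).
have GmE y z (g : mor D y z) : fmor F (Gm y z g) = kcomp (v z) (kcomp g (u y)) := preE _ _ _.
have Gm_linear y z : linear (Gm y z).
  move=> a f g; apply: inj; rewrite linearP !GmE.
  by rewrite (comp_linearl (u y)) (comp_linearr (v z)).
have Gm1 y : Gm y y (idm D y) = idm C (G y).
  by apply: inj; rewrite GmE comp1m vu fmor1.
have GmM x y z (g : mor D y z) (f : mor D x y) :
    Gm x z (kcomp g f) = kcomp (Gm y z g) (Gm x y f).
  apply: inj; rewrite fmorM !GmE !Defs.compA.
  by rewrite -[kcomp (kcomp (kcomp (v z) g) (u y)) (v y)]Defs.compA uv compm1.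
pose Gf : kfunctor D C := @KFunctor k D C G (fun y z => linear_of (@Gm_linear y z)) Gm1 GmM.
exists Gf; split.
  exists (fun x => pre _ _ (u (F x))), (fun x => pre _ _ (v (F x))); split=> [x|x|x y f].
  - by apply: inj; rewrite fmorM !preE vu fmor1.
  - by apply: inj; rewrite fmorM !preE uv fmor1.
  - apply: inj; rewrite !fmorM !preE.
    transitivity (kcomp (u (F y)) (kcomp (v (F y)) (kcomp (fmor F f) (u (F x))))).
      by congr kcomp; apply: GmE.
    by rewrite Defs.compA uv comp1m.
exists u, v; split=> // x y f.
transitivity (kcomp (u y) (kcomp (v y) (kcomp f (u x)))).
  by congr kcomp; apply: GmE.
by rewrite Defs.compA uv comp1m.
Qed.

Definition zero_mono C (x y : C) (f : mor C x y) :=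
  forall w (a : mor C w x), kcomp f a = 0 -> a = 0.
Definition zero_epi C (x y : C) (f : mor C x y) :=
  forall z (a : mor C y z), kcomp a f = 0 -> a = 0.
Definition mono_injective C (z : C) := forall x y (f : mor C x y) (a : mor C x z), zero_mono f ->
  exists b : mor C y z, kcomp b f = a.
Definition epi_projective C (z : C) := forall x y (f : mor C x y) (a : mor C z y), zero_epi f ->
  exists b : mor C z x, kcomp f b = a.

Section EquivalenceInvariance.
Variables (C D : kcat k) (F : kfunctor C D) (G : kfunctor D C).
Hypotheses (GF : nat_iso (compfunctor G F) (idfunctor C))
  (FG : nat_iso (compfunctor F G) (idfunctor D)).

Let ffG : fully_faithful G := equiv_fully_faithful FG GF.

(** Every object of [C] is isomorphic to one in the image of the fully faithful [G], so test maps
    come from [D]. *)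
Lemma zero_mono_fmor x y (f : mor D x y) : zero_mono f -> zero_mono (fmor G f).
Proof.
move=> f_mono w a fa; have [u [v [vu uv]]] := nat_iso_isomorphic w GF.
have [b bE] := (ffG (F w) x).2 (kcomp a u).
suff b0 : b = 0.
  by rewrite -[a]compm1 -uv Defs.compA -bE b0 linear0 comp_zerol.
apply: f_mono; apply: (ffG _ _).1.
by rewrite fmorM bE Defs.compA fa comp_zerol.
Qed.

Lemma zero_epi_fmor x y (f : mor D x y) : zero_epi f -> zero_epi (fmor G f).
Proof.
move=> f_epi w a fa; have [u [v [vu uv]]] := nat_iso_isomorphic w GF.
have [b bE] := (ffG y (F w)).2 (kcomp v a).
suff b0 : b = 0.
  by rewrite -[a]comp1m -uv -Defs.compA -bE b0 linear0 comp_zeror.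
apply: f_epi; apply: (ffG _ _).1.
by rewrite fmorM bE -Defs.compA fa comp_zeror.
Qed.

Lemma mono_injective_fobj z : mono_injective z -> mono_injective (F z).
Proof.
move=> injz x y f a f_mono; have [u [v [vu uv]]] := nat_iso_isomorphic z GF.
have [b bE] := injz _ _ (fmor G f) (kcomp u (fmor G a)) (zero_mono_fmor f_mono).
have [c cE] := (ffG y (F z)).2 (kcomp v b).
exists c; apply: (fully_faithful_inj ffG).
by rewrite fmorM cE -Defs.compA bE Defs.compA vu comp1m.
Qed.

Lemma epi_projective_fobj z : epi_projective z -> epi_projective (F z).
Proof.
move=> projz x y f a f_epi; have [u [v [vu uv]]] := nat_iso_isomorphic z GF.
have [b bE] := projz _ _ (fmor G f) (kcomp (fmor G a) v) (zero_epi_fmor f_epi).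
have [c cE] := (ffG (F z) x).2 (kcomp b u).
exists c; apply: (fully_faithful_inj ffG).
by rewrite fmorM cE Defs.compA bE -Defs.compA vu compm1.
Qed.

End EquivalenceInvariance.

Definition injproj C (z : C) := mono_injective z /\ epi_projective z.

Section FullSubcategory.
Variables (C : kcat k) (S : C -> Prop).

Definition full_subcat : kcat k :=
  @KCat k {x | S x} (fun x y => mor C (sval x) (sval y)) (fun x => idm C (sval x))
    (fun x y z => @Defs.comp k C _ _ _) (fun x y z t => @Defs.compA k C _ _ _ _)
    (fun x y => @comp1m k C _ _) (fun x y => @compm1 k C _ _)
    (fun x y z => @comp_linearl k C _ _ _) (fun x y z => @comp_linearr k C _ _ _).

Definition subfunctor D (F : kfunctor C D) : kfunctor full_subcat D :=
  @KFunctor k full_subcat D (fun x => F (sval x)) (fun x y => fmor F)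
    (fun x => fmor1 F (sval x)) (fun x y z => @fmorM k C D F _ _ _).

End FullSubcategory.
End LinearCategories.

(** * Functors on quotient categories *)

Section IdealQuotient.
Variables (k : fieldType) (C D : kcat k) (I : ideal C).

Lemma qpi_eq0 (x y : C) (f : mor C x y) : qpi I f = 0 <-> inI I f.
Proof.
have q0 : qpi I (0 : mor C x y) = 0.
  by apply: (addrI (qpi I 0)); rewrite -qpiD !addr0.
by rewrite -[f in inI _ f]subr0 -eq_qpi q0.
Qed.

Variable F : kfunctor C D.
Hypothesis FI : forall x y (f : mor C x y), inI I f -> fmor F f = 0.

Lemma fmor_qrepr (x y : C) (f : mor C x y) : fmor F (qrepr (qpi I f)) = fmor F f.
Proof.
apply/subr0_eq; rewrite -linearB; apply/FI/eq_qpi.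
exact: qreprK.
Qed.

Fact quotient_functor_linear (x y : C) :
  linear (fun f : mor (quotient_cat I) x y => fmor F (qrepr (f : qmor I x y))).
Proof.
move=> a f g; rewrite -[f]qreprK -[g]qreprK -[X in qrepr X]qpi_linear !fmor_qrepr.
exact: linearP.
Qed.

Definition quotient_functor : kfunctor (quotient_cat I) D.
refine (@KFunctor k (quotient_cat I) D (fun x => F x)
  (fun x y => linear_of (@quotient_functor_linear x y)) _ _).
- by move=> x /=; rewrite fmor_qrepr fmor1.
- by move=> x y z g f /=; rewrite fmor_qrepr fmorM.
Defined.

End IdealQuotient.

(** * Module maps as morphisms of the stable category *)

Section StableTranslation.
Variables (k : fieldType) (A : falgType k).

Lemma fdmodP (M : fdmod A) : finite_dim M.
Proof. by case: M. Qed.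

Lemma factors_projectiveE (M N : fdmod A) (f : modhom M N) :
  factors_projective f <-> stably_zero f.
Proof.
split=> [[P [g [h [projP ->]]]]|[P [u [v [fdP projP fE]]]]].
  by exists P, h, g; split=> //; exact: fdmodP.
exists (FDMod fdP), (v : modhom P N), (u : modhom M P); split=> //.
exact: modhomP.
Qed.

Definition stable_class (M N : fdmod A) (f : {linear M -> N}) : mor (stable_cat A) M N :=
  qpi (projective_ideal A) (f : modhom M N).

Lemma stable_class_ex (M N : fdmod A) (g : mor (stable_cat A) M N) :
  exists f, stable_class f = g.
Proof. by exists (qrepr (g : qmor (projective_ideal A) M N)); apply: qreprK. Qed.

Lemma stable_class_eq0 (M N : fdmod A) (f : {linear M -> N}) :
  stable_class f = 0 <-> stably_zero f.
Proof. by rewrite -factors_projectiveE; apply: (qpi_eq0 (projective_ideal A)). Qed.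

Lemma stable_class_eq (M N : fdmod A) (f g : {linear M -> N}) :
  stable_class f = stable_class g <-> stably_zero (fun x => f x - g x).
Proof.
split=> [/(@eq_qpi _ _ (projective_ideal A))/factors_projectiveE//|fg].
by apply/(@eq_qpi _ _ (projective_ideal A))/factors_projectiveE.
Qed.

Lemma stable_class_comp (M N P : fdmod A) (g : {linear N -> P}) (f : {linear M -> N}) :
  kcomp (stable_class g) (stable_class f) = stable_class (g \o f).
Proof.
exact/esym/(qpiM (projective_ideal A) (g : modhom N P) (f : modhom M N)).
Qed.

Lemma zero_mono_stable (M N : fdmod A) (f : {linear M -> N}) :
  zero_mono (stable_class f) <-> stable_mono f.
Proof.
split=> [f_mono W a fdW fa|f_mono W a].
  apply/(@stable_class_eq0 (FDMod fdW) M); apply: f_mono.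
  by rewrite (@stable_class_comp (FDMod fdW)); apply/stable_class_eq0.
have [a' <-] := stable_class_ex a; rewrite stable_class_comp => /stable_class_eq0 fa.
by apply/stable_class_eq0/f_mono => //; apply: fdmodP.
Qed.

Lemma zero_epi_stable (M N : fdmod A) (f : {linear M -> N}) :
  zero_epi (stable_class f) <-> stable_epi f.
Proof.
split=> [f_epi W a fdW fa|f_epi W a].
  apply/(@stable_class_eq0 N (FDMod fdW)); apply: f_epi.
  by rewrite (@stable_class_comp M N (FDMod fdW)); apply/stable_class_eq0.
have [a' <-] := stable_class_ex a; rewrite stable_class_comp => /stable_class_eq0 fa.
by apply/stable_class_eq0/f_epi => //; apply: fdmodP.
Qed.

Lemma injproj_stable (Z : fdmod A) :
  injproj (Z : stable_cat A) <-> stably_injective Z /\ stably_projective Z.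
Proof.
split=> [[injZ projZ]|[injZ projZ]]; split.
- move=> M N f a fdM fdN f_mono.
  have [b] := injZ (FDMod fdM) (FDMod fdN) (@stable_class (FDMod fdM) (FDMod fdN) f)
    (@stable_class (FDMod fdM) Z a)
    ((zero_mono_stable (M := FDMod fdM) (N := FDMod fdN) f).2 f_mono).
  have [b' <-] := stable_class_ex b; rewrite stable_class_comp => /stable_class_eq ba.
  by exists b'.
- move=> M N f a fdM fdN f_epi.
  have [b] := projZ (FDMod fdM) (FDMod fdN) (@stable_class (FDMod fdM) (FDMod fdN) f)
    (@stable_class Z (FDMod fdN) a)
    ((zero_epi_stable (M := FDMod fdM) (N := FDMod fdN) f).2 f_epi).
  have [b' <-] := stable_class_ex b; rewrite stable_class_comp => /stable_class_eq ba.
  by exists b'.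
- move=> M N f a; have [f' <-] := stable_class_ex f; have [a' <-] := stable_class_ex a.
  move=> /zero_mono_stable f_mono.
  have [b ba] := injZ M N f' a' (fdmodP M) (fdmodP N) f_mono.
  by exists (stable_class b); rewrite stable_class_comp; apply/stable_class_eq.
- move=> M N f a; have [f' <-] := stable_class_ex f; have [a' <-] := stable_class_ex a.
  move=> /zero_epi_stable f_epi.
  have [b ba] := projZ M N f' a' (fdmodP M) (fdmodP N) f_epi.
  by exists (stable_class b); rewrite stable_class_comp; apply/stable_class_eq.
Qed.

End StableTranslation.

(** * The kernel functor and its restriction to an equivalence *)

Section ArrowKernelFunctor.
Variables (k : fieldType) (A : falgType k).

Definition arrow_ker_obj (Z : fdmod (T2 A)) : fdmod A := FDMod (finite_dim_arrow_ker (fdmodP Z)).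

Definition arrow_ker_map (Y Z : fdmod (T2 A)) (f : modhom Y Z) :
    modhom (arrow_ker_obj Y) (arrow_ker_obj Z) :=
  projT1 (cid (arrow_ker_map_ex (f : {linear Y -> Z}))).

Lemma arrow_ker_mapE (Y Z : fdmod (T2 A)) (f : modhom Y Z) x :
  arrow_ker_inj (arrow_ker_map f x) = f (arrow_ker_inj x).
Proof. exact: (projT2 (cid (arrow_ker_map_ex (f : {linear Y -> Z})))). Qed.

Lemma arrow_ker_mapP (Y Z : fdmod (T2 A)) (f : modhom Y Z)
    (g : modhom (arrow_ker_obj Y) (arrow_ker_obj Z)) :
  (forall x, arrow_ker_inj (g x) = f (arrow_ker_inj x)) -> arrow_ker_map f = g.
Proof.
by move=> gf; apply: modhomP => x; apply: arrow_ker_injI; rewrite arrow_ker_mapE gf.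
Qed.

Fact arrow_ker_map_linear Y Z : linear (@arrow_ker_map Y Z).
Proof.
move=> a f g; apply: arrow_ker_mapP => x.
transitivity (arrow_ker_inj (a%:A *: arrow_ker_map f x + arrow_ker_map g x)); first by [].
by rewrite linearP !arrow_ker_mapE res_scaleE -t2mxZ.
Qed.

Definition arrow_ker_functor : kfunctor (mod_cat (T2 A)) (mod_cat A).
refine (@KFunctor k (mod_cat (T2 A)) (mod_cat A) arrow_ker_obj
  (fun Y Z => linear_of (@arrow_ker_map_linear Y Z)) _ _).
- by move=> Z; apply: arrow_ker_mapP.
- move=> X Y Z g f; apply: arrow_ker_mapP => x.
  transitivity (arrow_ker_inj (arrow_ker_map g (arrow_ker_map f x))); first by [].
  by rewrite !arrow_ker_mapE.
Defined.

(** A map through a projective [P] sends the arrow kernel of [Y] into that of [P], which is zero. *)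
Fact arrow_ker_functor_projective (Y Z : mod_cat (T2 A)) (f : mor _ Y Z) :
  inI (projective_ideal (T2 A)) f -> fmor arrow_ker_functor f = 0.
Proof.
move=> [P [g [h [projP ->]]]]; apply: arrow_ker_mapP => x.
pose h' : {linear Y -> P} := h; pose g' : {linear P -> Z} := g.
have h0 : h' (arrow_ker_inj x) = 0.
  apply: (projective_arrow_ker projP).
    by rewrite -(resl_idem2 h') arrow_ker_idem2; apply: (linear0 h').
  by rewrite -(resl_arrow h') arrow_ker_arrow; apply: (linear0 h').
transitivity (0 : res Z); first exact: (linear0 (arrow_ker_inj (Z := Z))).
exact: esym (etrans (congr1 g' h0) (linear0 g')).
Qed.

Definition stable_arrow_ker : kfunctor (stable_cat (T2 A)) (mod_cat A) :=
  quotient_functor arrow_ker_functor_projective.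

Lemma stable_arrow_kerE (Y Z : fdmod (T2 A)) (f : {linear Y -> Z}) :
  fmor stable_arrow_ker (stable_class f) = arrow_ker_map (f : modhom Y Z).
Proof. exact: (fmor_qrepr arrow_ker_functor_projective). Qed.

Hypothesis injA : self_injective A.

Definition injproj_arrow_ker :
    kfunctor (full_subcat (@injproj k (stable_cat (T2 A)))) (mod_cat A) :=
  subfunctor _ stable_arrow_ker.

Lemma injproj_arrow_ker_ff : fully_faithful injproj_arrow_ker.
Proof.
move=> [Y iY] [Z iZ]; have /injproj_stable[injY _] := iY; have /injproj_stable[_ projZ] := iZ.
(* The injective half of the condition on [Y] yields a projective cokernel, the projective half on
   [Z] a projective source. *)
have cokY := projective_vertex_coker (fdmodP Y) injY.
have srcZ := stably_projective_source (fdmodP Z) projZ.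
split=> [f|h].
  have [f' <-] := @stable_class_ex _ _ Y Z f => f0.
  apply/(@stable_class_eq0 _ _ Y Z)/(arrow_ker_faithful injA (fdmodP Y) cokY srcZ) => x.
  have f'0 := etrans (esym (stable_arrow_kerE f')) f0.
  have := arrow_ker_mapE (f' : modhom Y Z) x; rewrite f'0 => f'x.
  exact: etrans (esym f'x) (linear0 (arrow_ker_inj (Z := Z))).
have [f fE] := arrow_ker_full injA cokY srcZ (h : {linear arrow_ker Y -> arrow_ker Z}).
exists (@stable_class _ _ Y Z f).
transitivity (arrow_ker_map (f : modhom Y Z)); first exact: stable_arrow_kerE.
exact: arrow_ker_mapP.
Qed.

(** Once embedded in a projective [P], the module [M] is the kernel of P -> P/M. *)
Lemma injproj_arrow_ker_es : essentially_surjective injproj_arrow_ker.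
Proof.
move=> M; have [P [fdP projP injP [j j_inj]]] := projective_embedding injA (fdmodP M).
pose Z : fdmod (T2 A) := FDMod (finite_dim_quotrep j fdP).
have injprojZ : injproj (Z : stable_cat (T2 A)).
  apply/injproj_stable; split.
    exact: stably_injective_quotrep.
  exact: stably_projective_quotrep.
exists (exist _ _ injprojZ).
have [u [v [uv vu]]] := arrow_ker_quotrep j_inj.
by exists (u : modhom (arrow_ker_obj Z) M), (v : modhom M (arrow_ker_obj Z));
  split; apply: modhomP.
Qed.

End ArrowKernelFunctor.

(** * Transport along the stable equivalence *)

Section InjprojEquivalence.
Variables (k : fieldType) (C D : kcat k) (F : kfunctor C D) (G : kfunctor D C).
Hypotheses (GF : nat_iso (compfunctor G F) (idfunctor C))
  (FG : nat_iso (compfunctor F G) (idfunctor D)).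

Fact injproj_fobj x : injproj x -> injproj (F x).
Proof.
by case=> injx projx; split;
  [apply: mono_injective_fobj GF FG _ injx | apply: epi_projective_fobj GF FG _ projx].
Qed.

Definition injproj_functor : kfunctor (full_subcat (@injproj k C)) (full_subcat (@injproj k D)) :=
  @KFunctor k (full_subcat (@injproj k C)) (full_subcat (@injproj k D))
    (fun x => exist _ (F (sval x)) (injproj_fobj (svalP x)))
    (fun x y => fmor F) (fun x => fmor1 F (sval x)) (fun x y z => @fmorM k C D F _ _ _).

Lemma injproj_functor_ff : fully_faithful injproj_functor.
Proof. by move=> x y; apply: (equiv_fully_faithful GF FG). Qed.

End InjprojEquivalence.

Lemma injproj_functor_es (k : fieldType) (C D : kcat k) (F : kfunctor C D) (G : kfunctor D C)
    (GF : nat_iso (compfunctor G F) (idfunctor C))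
    (FG : nat_iso (compfunctor F G) (idfunctor D)) :
  essentially_surjective (injproj_functor GF FG).
Proof.
move=> [y iy]; exists (exist _ (G y) (injproj_fobj FG GF iy)).
exact: (nat_iso_isomorphic y FG).
Qed.

Theorem proposition2p1 (k : fieldType) (A B : falgType k)
    (injA : self_injective A) (injB : self_injective B)
    (nssA : no_semisimple_summand A) (nssB : no_semisimple_summand B)
    (stableT2 : stably_equivalent (T2 A) (T2 B)) :
  morita_equivalent A B.
Proof.
have [F [G [GF FG]]] := stableT2.
have [K [KA AK]] := fully_faithful_inverse (injproj_arrow_ker_ff injA)
  (injproj_arrow_ker_es injA).
(* The functor [H] goes from mod A back to the subcategory for [T2 A], across the stable
   equivalence, then by kernels to mod B. *)
pose H := compfunctor (injproj_arrow_ker B) (compfunctor (injproj_functor GF FG) K).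
have ffH : fully_faithful H.
  apply: fully_faithful_comp; first exact: injproj_arrow_ker_ff.
  apply: fully_faithful_comp; first exact: injproj_functor_ff.
  exact: equiv_fully_faithful AK KA.
have esH : essentially_surjective H.
  apply: essentially_surjective_comp; first exact: injproj_arrow_ker_es.
  apply: essentially_surjective_comp; first exact: injproj_functor_es.
  move=> x; exists (injproj_arrow_ker A x).
  exact: nat_iso_isomorphic x KA.
have [H' [HH' H'H]] := fully_faithful_inverse ffH esH.
by exists H, H'.
Qed.
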